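(* Let $(U_n)$ be the signal process and $\{V_n^{(k)}\}_{k=1}^K$ the EnKF ensemble process described in the context, and put $X_n=(U_n,V_n^{(1)},\dots,V_n^{(K)})$. Assume: (a) (Kinetic energy principle) there exist $\beta_h\in(0,1)$, $K_h>0$ with $|\Psi_h(u)|^2+\mathrm{tr}(R_h(u))\le(1-\beta_h)|u|^2+K_h$ for all $u\in\mathbb{R}^d$. (b) (Nondegenerate system noise) for any $M_1,M_2>0$ there is $\alpha>0$ such that $\mathbb{P}(\zeta_n\in\cdot\mid U_{n-1}=u)\ge\alpha\,\lambda_{M_2}(\cdot)$ for all $|u|\le M_1$, where $\lambda_{M_2}$ is Lebesgue measure on $\mathbb{R}^d$ restricted to $\{x:|x|\le M_2\}$. (c) (Strong Lyapunov function) there are a function $\mathcal{E}:\mathbb{R}^d\times\mathbb{R}^{d\times K}\to[0,\infty)$ with compact sub-level sets and constants $\beta\in(0,1)$, $c>0$ such that $\mathbb{E}_{n-1}\mathcal{E}(X_n)\le(1-\beta)\mathcal{E}(X_{n-1})+c$ for all $n\ge1$ (for every initial condition). Then the EnKF signal-ensemble process $X_n$ is geometrically ergodic in total variation distance.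
   Context: Signal and observations. Fix $h>0$, integers $1\le q\le d$, $K\ge2$, and $H\in\mathbb{R}^{q\times d}$ of rank $q$. $\Psi_h:\mathbb{R}^d\to\mathbb{R}^d$ is a measurable map. The signal in $\mathbb{R}^d$ and observation in $\mathbb{R}^q$ are $$U_n=\Psi_h(U_{n-1})+\zeta_n,\qquad Z_n=HU_n+\xi_n .$$ Given the past up to time $n-1$, the law of $\zeta_n$ depends only on $U_{n-1}$ (through a time-independent kernel); given $U_{n-1}=u$ it has mean $0$ and covariance matrix $R_h(u)$. The $\xi_n$ are i.i.d. with mean $0$ and covariance $I_q$, independent of everything else. EnKF. Given the ensemble $\{V_{n-1}^{(k)}\}_{k=1}^K\subset\mathbb{R}^d$: Forecast: $\widehat V_n^{(k)}=\Psi_h(V_{n-1}^{(k)})+\zeta_n^{(k)}$, where $\zeta_n^{(k)}$ has the conditional law that $\zeta_n$ has given $U_{n-1}=V_{n-1}^{(k)}$. Put $\overline{\widehat V}_n=\frac1K\sum_k\widehat V_n^{(k)}$ and $\widehat C_n=\frac1{K-1}\sum_k(\widehat V_n^{(k)}-\overline{\widehat V}_n)(\widehat V_n^{(k)}-\overline{\widehat V}_n)^T$. Analysis: $Z_n^{(k)}=Z_n+\xi_n^{(k)}$, with $\xi_n^{(k)}$ distributed as $\xi_n$, and $$V_n^{(k)}=\widehat V_n^{(k)}-\widehat C_nH^T(I+H\widehat C_nH^T)^{-1}(H\widehat V_n^{(k)}-Z_n^{(k)}).$$ Given the past up to time $n-1$, the noises $\zeta_n,\zeta_n^{(1)},\dots,\zeta_n^{(K)},\xi_n,\xi_n^{(1)},\dots,\xi_n^{(K)}$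 are independent. $X_n$ is a Markov chain on $\mathbb{R}^d\times\mathbb{R}^{d\times K}$; $\mathcal{F}_n=\sigma\{X_m:m\le n\}$ and $\mathbb{E}_n$ is conditional expectation given $\mathcal{F}_n$. Geometric ergodicity (in total variation) of $X_n$ means: there is a unique invariant probability measure $\pi$ and constants $r\in(0,1)$, $\kappa>0$ such that for every initial probability distribution $\mu$ and all $n\ge0$, $\|\mathbb{P}^\mu(X_n\in\cdot)-\pi\|_{TV}\le\kappa r^n\big(1+\int\mathcal{E}\,d\mu\big)$. In particular, for initial laws $\mu,\nu$ integrating $\mathcal{E}$ and $P$ the transition kernel, $\|P^n\mu-P^n\nu\|_{TV}\le C_{\mu,\nu}r^n$. *)

(* Defs.v *)
From HB Require Import structures.
From mathcomp Require Import all_boot all_order all_algebra.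
From mathcomp Require Import all_classical all_reals all_analysis.
From mathcomp Require Import measurable_realfun.

Set Implicit Arguments.
Unset Strict Implicit.
Unset Printing Implicit Defensive.
Import Order.TTheory GRing.Theory Num.Theory.
Import numFieldNormedType.Exports.
Local Open Scope classical_set_scope.
Local Open Scope ring_scope.

(* Matrices, hence the vectors 'cV[R]_n of R^n, carry the Borel sigma-algebra. *)
Section borel_matrix.
Variables (R : realType) (m n : nat).

HB.instance Definition _ :=
  @isMeasurable.Build (@open 'M[R]_(m, n)).-sigma%mdisp 'M[R]_(m, n)
    <<s @open 'M[R]_(m, n) >> (@sigma_algebra0 _ setT _)
    (@sigma_algebraC _ _) (@sigma_algebra_bigcup _ setT _).

End borel_matrix.

Section euclidean.
Variable R : realType.

(* The library norm `|u| on matrices is the sup norm. *)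
Definition enorm n (u : 'cV[R]_n) : R := Num.sqrt (\sum_i u i 0 ^+ 2).

Definition eball n (M : R) : set 'cV[R]_n := [set x | enorm x <= M].

(* Lebesgue measure of a Borel set of R^n, as the n-fold product (by iterated
   integrals over the first coordinate) of the Lebesgue measure on R. *)
Fixpoint lebesgue_cV (n : nat) : set 'cV[R]_n -> \bar R :=
  match n with
  | 0 => fun A => (\1_A 0)%:E
  | n'.+1 => fun A => (\int[@lebesgue_measure R]_t
      lebesgue_cV [set v : 'cV[R]_n' | A (col_mx (t%:M : 'cV[R]_1) v)])%E
  end.

(* The integrability of the squares makes all the integrals below finite. *)
Definition has_mean_cov n (mu : {measure set 'cV[R]_n -> \bar R})
    (m : 'cV[R]_n) (C : 'M[R]_n) : Prop :=
  [/\ forall i, mu.-integrable setT (fun x => (x i 0 ^+ 2)%:E),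
      forall i, (\int[mu]_x (x i 0)%:E = (m i 0)%:E)%E &
      forall i j,
        (\int[mu]_x ((x i 0 - m i 0) * (x j 0 - m j 0))%:E = (C i j)%:E)%E].

End euclidean.

Section probability.
Variable R : realType.

(* sup_A |mu A - nu A|; the other usual normalization of the total variation
   norm is twice this one. *)
Definition tv_dist d (T : measurableType d) (mu nu : set T -> \bar R) : \bar R :=
  ereal_sup [set `|mu A - nu A|%E | A in measurable].

(* Y is a version of the conditional expectation of the nonnegative f given G *)
Definition is_cond_exp d (T : measurableType d) (P : probability T R)
    (G : set (set T)) (f Y : T -> \bar R) : Prop :=
  [/\ forall w, (0 <= Y w)%E,
      forall B : set (\bar R), measurable B -> G (Y @^-1` B) &
      forall A, G A -> (\int[P]_(w in A) Y w = \int[P]_(w in A) f w)%E].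

Definition past d d' (Omega : measurableType d) (T : measurableType d')
    (X : nat -> Omega -> T) (n : nat) : set (set Omega) :=
  <<s \bigcup_(m in [set m | (m <= n)%N])
        preimage_set_system setT (X m) measurable >>.

End probability.

(* In this section Pr mu is the law on Omega under which the Markov chain X has
   initial distribution mu. *)
Section ergodicity.
Context (R : realType) d d' (Omega : measurableType d) (T : measurableType d').
Variables (Pr : probability T R -> probability Omega R) (X : nat -> Omega -> T).

Definition transition (x : T) (A : set T) : \bar R :=
  Pr [the probability T R of \d_x] (X 1%N @^-1` A).

Definition invariant (pi : probability T R) : Prop :=
  forall A, measurable A -> (\int[pi]_x transition x A = pi A)%E.

Definition geometrically_ergodic (E : T -> R) : Prop :=
  exists pi : probability T R,
    [/\ invariant pi,
        forall pi' : probability T R, invariant pi' ->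
          forall A, measurable A -> pi' A = pi A &
        exists r kappa : R, [/\ 0 < r < 1, 0 < kappa &
          forall (mu : probability T R) (n : nat),
            (tv_dist (pushforward (Pr mu) (X n)) pi
              <= (kappa * r ^+ n)%:E * (1 + \int[mu]_x (E x)%:E))%E]].

End ergodicity.

Section enkf.
Context (R : realType) (d q K : nat).

(* An ensemble is the d x K matrix whose k-th column is its k-th member. *)

Definition ens_mean (W : 'M[R]_(d, K)) : 'cV[R]_d :=
  K%:R^-1 *: \sum_k col k W.

Definition ens_cov (W : 'M[R]_(d, K)) : 'M[R]_d :=
  (K%:R - 1)^-1 *:
    \sum_k (col k W - ens_mean W) *m (col k W - ens_mean W)^T.

Definition kalman_gain (H : 'M[R]_(q, d)) (C : 'M[R]_d) : 'M[R]_(d, q) :=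
  C *m H^T *m invmx (1%:M + H *m C *m H^T).

Definition forecast (Psi : 'cV[R]_d -> 'cV[R]_d) (V : 'M[R]_(d, K))
    (zeta : 'I_K -> 'cV[R]_d) : 'M[R]_(d, K) :=
  \matrix_(i, k) (Psi (col k V) + zeta k) i 0.

Definition analysis (H : 'M[R]_(q, d)) (W : 'M[R]_(d, K))
    (Z : 'I_K -> 'cV[R]_q) : 'M[R]_(d, K) :=
  \matrix_(i, k)
    (col k W - kalman_gain H (ens_cov W) *m (H *m col k W - Z k)) i 0.

Context dO (Omega : measurableType dO).

(* The values at time 0 of the observation and of the noises play no role. *)
Record enkf_process := EnkfProcess {
  signal : nat -> Omega -> 'cV[R]_d ;
  ensemble : nat -> Omega -> 'M[R]_(d, K) ;
  obs : nat -> Omega -> 'cV[R]_q ;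
  sys_noise : nat -> Omega -> 'cV[R]_d ;
  ens_sys_noise : nat -> 'I_K -> Omega -> 'cV[R]_d ;
  obs_noise : nat -> Omega -> 'cV[R]_q ;
  ens_obs_noise : nat -> 'I_K -> Omega -> 'cV[R]_q }.

Definition state (p : enkf_process) (n : nat) (w : Omega) :
    'cV[R]_d * 'M[R]_(d, K) :=
  (signal p n w, ensemble p n w).

Record enkf_dynamics (Psi : 'cV[R]_d -> 'cV[R]_d) (H : 'M[R]_(q, d))
    (p : enkf_process) : Prop := {
  measurable_signal : forall n, measurable_fun setT (signal p n) ;
  measurable_ensemble : forall n, measurable_fun setT (ensemble p n) ;
  measurable_sys_noise : forall n, measurable_fun setT (sys_noise p n) ;
  measurable_ens_sys_noise :
    forall n k, measurable_fun setT (ens_sys_noise p n k) ;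
  measurable_obs_noise : forall n, measurable_fun setT (obs_noise p n) ;
  measurable_ens_obs_noise :
    forall n k, measurable_fun setT (ens_obs_noise p n k) ;
  signal_step : forall n w,
    signal p n.+1 w = Psi (signal p n w) + sys_noise p n.+1 w ;
  obs_step : forall n w,
    obs p n.+1 w = H *m signal p n.+1 w + obs_noise p n.+1 w ;
  ensemble_step : forall n w,
    ensemble p n.+1 w =
      analysis H
        (forecast Psi (ensemble p n w) (fun k => ens_sys_noise p n.+1 k w))
        (fun k => obs p n.+1 w + ens_obs_noise p n.+1 k w) }.

(* noise_law: given the past up to time n, the noises at time n + 1 are
   independent; a system noise has law Q u with u the position at time n of the
   signal, or of the ensemble member, that it drives; an observation noise has
   law nu. *)
Record enkf_law (Q : R.-pker 'cV[R]_d ~> 'cV[R]_d)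
    (nu : probability 'cV[R]_q R) (P : probability Omega R)
    (mu : probability ('cV[R]_d * 'M[R]_(d, K))%type R)
    (p : enkf_process) : Prop := {
  initial_law : forall A, measurable A -> P (state p 0 @^-1` A) = mu A ;
  noise_law : forall n (A : set 'cV[R]_d) (A' : 'I_K -> set 'cV[R]_d)
      (B : set 'cV[R]_q) (B' : 'I_K -> set 'cV[R]_q),
    measurable A -> (forall k, measurable (A' k)) ->
    measurable B -> (forall k, measurable (B' k)) ->
    is_cond_exp P (past (state p) n)
      (fun w => (\1_[set w | [/\ A (sys_noise p n.+1 w),
                                 forall k, A' k (ens_sys_noise p n.+1 k w),
                                 B (obs_noise p n.+1 w) &
                                 forall k, B' k (ens_obs_noise p n.+1 k w)]]
                   w)%:E)
      (fun w => Q (signal p n w) A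
                * (\prod_(k < K) Q (col k (ensemble p n w)) (A' k))
                * nu B * (\prod_(k < K) nu (B' k)))%E }.

End enkf.

(* Main.v *)
Require Import Defs.
From HB Require Import structures.
From mathcomp Require Import all_boot all_order all_algebra.
From mathcomp Require Import all_classical all_reals all_analysis.
From mathcomp Require Import measurable_realfun.
From mathcomp Require Import ring lra.

(** Harris' theorem. On the sublevel sets of E all one-step laws P x dominate a
    common nonzero measure: these sets are compact, the kinetic energy bound
    keeps Psi bounded there, and the system noise has a density bounded below on
    large balls, so the forecasts and the observation noises dominate a product
    measure independent of x, which the analysis map carries to the state space.
    Following Hairer and Mattingly, with W = 1 + b E and b small, this and the
    drift of E make P contract the seminorm
    sup (phi x - phi y) / (W x + W y) by a factor rho < 1. Applied to
    phi = 1_A this shows that P^n x A is Cauchy uniformly in A; its setwise limit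
    is the invariant law. *)

Set Implicit Arguments.
Unset Strict Implicit.
Unset Printing Implicit Defensive.
Import Order.TTheory GRing.Theory Num.Theory.
Import numFieldNormedType.Exports.
Local Open Scope classical_set_scope.
Local Open Scope ring_scope.

(** The data are random variables and conditional expectations under laws [Pr mu], with no
    regularity in [mu], whereas Harris' theorem needs a measurable kernel. The kernel is rebuilt
    from the noises: a product law for each state, measurable in the state because it is so on
    rectangles; conditioning on the current state shows that the laws of the chain obey it. One step
    is a translation of the noises by [Psi], followed by a map that does not see the current state,
    so only the translation has to be made uniform. For positions in a bounded set, one large ball
    contains every translate by [- Psi u] of the unit box, hence all forecasts dominate the same
    multiple of the uniform law on that box. The contraction is proved for test functions with
    values in [0, 1]: iterates of indicators stay in this class and their integrals are finite. The
    Cauchy bound is uniform in the set, and this makes the setwise limit countably additive. *)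

Section measure_integral.
Context d (T : measurableType d) (R : realType).
Implicit Types (mu nu m : {measure set T -> \bar R}) (f g : T -> R).
Local Open Scope ereal_scope.

(** A probability is a kernel from the one-point space [unit]; read this way, [nu] is a composition
    of kernels. *)
Lemma ge0_integral_mixture d' (S : measurableType d') (mu : probability S R)
    (k : R.-pker S ~> T) nu (f : T -> \bar R) :
  (forall A, measurable A -> nu A = \int[mu]_x k x A) ->
  (forall x, 0 <= f x) -> measurable_fun setT f ->
  \int[nu]_y f y = \int[mu]_x \int[k x]_y f y.
Proof.
move=> nuE f0 mf.
pose l := kprobability (@measurable_cst _ _ unit (pprobability S R) setT
  (mu : pprobability S R)).
pose k2 := kernel.kernel_snd k : unit * S -> {measure set T -> \bar R}.
have <- := @integral_kcomp _ _ _ unit S T R l k2 tt f f0 mf.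
by apply: eq_measure_integral => A mA _; rewrite nuE.
Qed.

Lemma integral_cst_probability mu r : mu setT = 1 -> \int[mu]_x r = r.
Proof.
by move=> mu1; rewrite -[RHS]mule1 -mu1; exact: integral_cst.
Qed.

Lemma integrable_cst_probability mu (a : R) : mu setT = 1 ->
  mu.-integrable setT (EFin \o cst a).
Proof.
move=> mu1; apply: measurable_bounded_integrable => //; first by rewrite mu1 ltry.
exact: bounded_cst.
Qed.

Lemma integrable_bounded01 mu f : mu setT = 1 ->
  measurable_fun setT f -> (forall x, (0 <= f x <= 1)%R) ->
  mu.-integrable setT (EFin \o f).
Proof.
move=> mu1 mf f01; apply: measurable_bounded_integrable => //.
  by rewrite mu1 ltry.
exists 1%R; split => // M M1 x _ /=; have /andP[f0 f1] := f01 x.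
by rewrite ger0_norm// (le_trans f1)// ltW.
Qed.

Lemma integral_bounded01 mu f : mu setT = 1 ->
  measurable_fun setT f -> (forall x, (0 <= f x <= 1)%R) ->
  0 <= \int[mu]_x (f x)%:E <= 1.
Proof.
move=> mu1 mf f01; apply/andP; split.
  by apply: integral_ge0 => x _; rewrite lee_fin; case/andP: (f01 x).
apply: (@le_trans _ _ (\int[mu]_x (cst 1 x))).
  apply: ge0_le_integral => //.
  - by move=> x _; rewrite lee_fin; case/andP: (f01 x).
  - exact/measurable_EFinP.
  - by move=> x _; rewrite lee_fin; case/andP: (f01 x).
by rewrite integral_cst_probability.
Qed.

(** Since [mu] has mass 1, [a] moves under the integral. Oscillation bounds on iterated kernels
    become bounds on laws of the chain in this way. *)
Lemma dist_integral_le mu f (a G : R) g : mu setT = 1 ->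
  measurable_fun setT f -> (forall x, (0 <= f x <= 1)%R) ->
  measurable_fun setT g -> (forall x, (`|f x - a| <= g x)%R) ->
  \int[mu]_x (g x)%:E <= G%:E -> (`|fine (\int[mu]_x (f x)%:E) - a| <= G)%R.
Proof.
move=> mu1 mf f01 mg fg gG.
have If := integrable_bounded01 mu1 mf f01.
have Ia : mu.-integrable setT (EFin \o cst a).
  exact: integrable_cst_probability.
rewrite -lee_fin -abse_EFin; apply: le_trans gG.
have -> : (fine (\int[mu]_x (f x)%:E) - a)%:E = \int[mu]_x (f x - a)%:E.
  rewrite EFinB fineK; last exact: integrable_fin_num.
  under [RHS]eq_integral do rewrite EFinB.
  rewrite integralB//; congr (_ - _).
  by rewrite integral_cst_probability.
have mfa : measurable_fun setT (fun x => (f x - a)%:E).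
  by apply/measurable_EFinP; apply: measurable_funB.
apply: (le_trans (le_abse_integral _ _ _)) => //.
apply: ge0_le_integral => //.
- exact: measurableT_comp.
- exact/measurable_EFinP.
- by move=> x _; rewrite abse_EFin lee_fin.
Qed.

End measure_integral.

Lemma ge0_integral_image d d' (T : measurableType d) (S : measurableType d')
    (R : realType) (P : {measure set T -> \bar R}) (nu : {measure set S -> \bar R})
    (f : T -> S) (D : set S) (g : S -> \bar R) :
  measurable_fun setT f ->
  (forall A, measurable A -> nu A = P (f @^-1` A)) ->
  measurable D -> measurable_fun D g -> (forall y, 0 <= g y)%E ->
  (\int[nu]_(y in D) g y = \int[P]_(x in f @^-1` D) g (f x))%E.
Proof.
move=> mf nuE mD mg g0.
rewrite -[RHS]/(\int[P]_(x in f @^-1` D) (g \o f) x)%E.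
rewrite -(ge0_integral_pushforward mf)//.
by apply: eq_measure_integral => A mA _; exact: nuE.
Qed.

(** * Setwise limits of probabilities *)

Section setwise_limit.
Context d (T : measurableType d) (R : realType).
Variables (m : nat -> probability T R) (e : nat -> R).
Hypothesis e0 : e n @[n --> \oo] --> 0.
Hypothesis me : forall n k A, measurable A ->
  `|fine (m (n + k)%N A) - fine (m n A)| <= e n.

Let u A n := fine (m n A).
(* The absolute value only matters on non-measurable sets. *)
Let v A := `|limn (u A)|.

Let cvg_u A : measurable A -> u A n @[n --> \oo] --> v A.
Proof.
move=> mA; have cu : cvgn (u A).
  apply/cauchy_cvgP/cauchyP => eps eps0.
  have /cvgrPdist_lt/(_ eps eps0)[N _ /(_ N (leqnn N))] := e0.
  rewrite /= sub0r normrN => eN.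
  exists (u A N); exists N => // n /= Nn; rewrite /ball /= distrC -(subnKC Nn).
  by apply: le_lt_trans (me N (n - N) mA) _; apply: le_lt_trans eN; exact: ler_norm.
rewrite /v ger0_norm //; apply: limr_ge => //.
by apply: nearW => n; rewrite /u fine_ge0.
Qed.

Let u_v n A : measurable A -> `|u A n - v A| <= e n.
Proof.
move=> mA.
have h : `|u A n - u A (n + k)%N| @[k --> \oo] --> `|u A n - v A|.
  apply: cvg_norm; apply: cvgB; first exact: cvg_cst.
  have := cvg_u mA; rewrite -(cvg_shiftn n); apply: cvg_trans.
  by apply: near_eq_cvg; apply: nearW => k; rewrite addnC.
rewrite -(cvg_lim _ h)//; apply: limr_le; first exact: cvgP h.
by apply: nearW => k; rewrite distrC; exact: me.
Qed.

Let v_semi_additive (F : nat -> set T) n : (forall i, measurable (F i)) ->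
  trivIset setT F -> v (\big[setU/set0]_(i < n) F i) = \sum_(0 <= i < n) v (F i).
Proof.
move=> mF tF.
have h : u (\big[setU/set0]_(i < n) F i) k @[k --> \oo] -->
    \sum_(0 <= i < n) v (F i).
  rewrite (_ : u _ = fun k => \sum_(0 <= i < n) u (F i) k).
    elim: n => [|n IHn].
      under eq_fun do rewrite big_nil; rewrite big_nil; exact: cvg_cst.
    under eq_fun do rewrite big_nat_recr//=; rewrite big_nat_recr//=.
    by apply: cvgD => //; exact: cvg_u.
  apply/funext => k; rewrite /u measure_semi_additive//; last first.
    exact: bigsetU_measurable.
  by rewrite big_mkord sum_fine// => i _; exact: fin_num_measure.
apply: (cvg_unique _ _ h) => //; apply: cvg_u; exact: bigsetU_measurable.
Qed.

(** The bound [e N] holds for all sets at once. With [e N <= eps / 3], additivity of [m N] gives one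
    third; replacing [m N] by the limit costs another third on the full union and one on the partial
    union. *)
Let v_sigma_additive : semi_sigma_additive (EFin \o v).
Proof.
move=> F mF tF mU; rewrite (_ : (fun n => _) =
    EFin \o (fun n => \sum_(0 <= i < n) v (F i))); last first.
  by apply/funext => n /=; rewrite sumEFin.
apply: cvg_EFin; first exact: nearW.
rewrite [X in X @ _](_ : _ = fun n => \sum_(0 <= i < n) v (F i)); last first.
  by apply/funext => n.
apply/cvgrPdist_le => eps eps0.
have e30 : 0 < eps / 3 by rewrite divr_gt0.
have /cvgrPdist_lt/(_ _ e30)[N _ /(_ N (leqnn N))] := e0.
rewrite /= sub0r normrN => eN.
have {}eN : e N <= eps / 3 by apply: ltW; apply: le_lt_trans eN; exact: ler_norm.
have : (fun n => fine (\sum_(0 <= i < n) m N (F i))) n @[n --> \oo] --> u (\bigcup_i F i) N.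
  apply: fine_cvg; rewrite /u fineK; last exact: fin_num_measure.
  exact: measure_semi_sigma_additive.
move=> /cvgrPdist_le/(_ _ e30)[M _ hM]; exists M => // n /= /hM /=.
have mB : measurable (\big[setU/set0]_(i < n) F i) by exact: bigsetU_measurable.
rewrite -v_semi_additive// big_mkord -measure_semi_additive//.
have := u_v N mU; have := u_v N mB; rewrite /u.
rewrite !ler_norml => /andP[? ?] /andP[? ?] /andP[? ?].
apply/andP; split; lra.
Qed.

Let v0 : (EFin \o v) set0 = 0%E.
Proof.
congr EFin; apply: (cvg_unique _ (cvg_u measurable0)) => //.
rewrite (_ : u _ = cst 0); first exact: cvg_cst.
by apply/funext => n; rewrite /u measure0.
Qed.

Let v_ge0 A : (0 <= (EFin \o v) A)%E.
Proof. by rewrite /= lee_fin normr_ge0. Qed.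

Let v_measure : {measure set T -> \bar R} :=
  HB.pack (EFin \o v) (isMeasure.Build _ _ _ _ v0 v_ge0 v_sigma_additive).

Let v_setT : v_measure setT = 1%E.
Proof.
congr EFin; apply: (cvg_unique _ (cvg_u measurableT)) => //.
rewrite (_ : u _ = cst 1); first exact: cvg_cst.
by apply/funext => n; rewrite /u probability_setT.
Qed.

Let v_probability : probability T R :=
  HB.pack (Measure.sort v_measure) (Measure_isProbability.Build _ _ _ v_measure v_setT).

Lemma setwise_cauchy_limit : exists pi : probability T R,
  forall n A, measurable A -> `|fine (m n A) - fine (pi A)| <= e n.
Proof. by exists v_probability => n A mA; exact: u_v. Qed.

End setwise_limit.

Section setwise_fatou.
Context d (T : measurableType d) (R : realType).
Import HBNNSimple.
Local Open Scope ereal_scope.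

(** Fatou's inequality for setwise convergence: the integral of a simple function is a finite
    combination of measures of sets, so it converges, and simple functions below [f] exhaust its
    integral. *)
Lemma ge0_integral_setwise_limit_le (m : nat -> probability T R)
    (pi : probability T R) (f : T -> \bar R) (a : nat -> R) (l : R) :
  (forall A, measurable A -> m n A @[n --> \oo] --> pi A) ->
  (forall x, 0 <= f x) -> measurable_fun setT f ->
  (forall n, \int[m n]_x f x <= (a n)%:E) -> (a n @[n --> \oo] --> l)%R ->
  \int[pi]_x f x <= l%:E.
Proof.
move=> mpi f0 mf fa al; rewrite ge0_integralTE//.
apply: ge_ereal_sup => _ [h /= hf <-].
have cvg_sum_h (s : seq R) :
    (fun n => \sum_(r <- s) (r%:E * m n (h @^-1` [set r]))) @ \oo -->
    \sum_(r <- s) (r%:E * pi (h @^-1` [set r])).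
  elim: s => [|r s IHs].
    rewrite big_nil (_ : (fun n => _) = cst 0); first exact: cvg_cst.
    by apply/funext => n; rewrite big_nil.
  rewrite big_cons (_ : (fun n => _) = fun n => r%:E * m n (h @^-1` [set r]) +
    \sum_(r <- s) (r%:E * m n (h @^-1` [set r]))); last first.
    by apply/funext => n; rewrite big_cons.
  apply: cvgeD => //.
    rewrite fin_num_adde_defl//; apply/sum_fin_numP => i _ _.
    by rewrite fin_numM// fin_num_measure.
  by apply: cvgeZl => //; exact: mpi.
have cvg_h : (fun n => sintegral (m n) h) @ \oo --> sintegral pi h.
  rewrite sintegralE fsbig_finite// (_ : (fun n => _) = fun n =>
    \sum_(r <- finmap.enum_fset (fset_set (range h)))
      (r%:E * m n (h @^-1` [set r]))); first exact: cvg_sum_h.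
  by apply/funext => n; rewrite sintegralE fsbig_finite.
rewrite -(cvg_lim _ cvg_h)//.
have cvg_a : (EFin \o a) n @[n --> \oo] --> l%:E.
  by apply: cvg_EFin => //; exact: nearW.
rewrite -(cvg_lim _ cvg_a)//.
apply: lee_lim; [exact: cvgP cvg_h|exact: cvgP cvg_a|].
apply: nearW => n; apply: le_trans (fa n).
rewrite ge0_integralTE//.
by apply: ereal_sup_ubound; exists h.
Qed.

End setwise_fatou.

(** * Contraction of the weighted seminorm *)

Section harris_contraction.
Context d (T : measurableType d) (R : realType).
Variables (P : R.-pker T ~> T) (E : T -> R) (gamma c : R).
Hypotheses (mE : measurable_fun setT E) (E0 : forall x, 0 <= E x).
Hypotheses (gamma01 : 0 < gamma < 1) (c0 : 0 < c).
Hypothesis drift : forall x, (\int[P x]_y (E y)%:E <= (gamma * E x + c)%:E)%E.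

Let integrable_E x : (P x).-integrable setT (EFin \o E).
Proof.
apply/integrableP; split; first exact/measurable_EFinP.
under eq_integral do rewrite /= ger0_norm//.
exact: le_lt_trans (drift x) (ltry _).
Qed.

Let integral_affine x (s a t : R) (f : T -> R) : measurable_fun setT f ->
  (forall x, 0 <= f x <= 1) ->
  (\int[P x]_y (s * E y + a + t * f y)%:E =
   (s * fine (\int[P x]_y (E y)%:E) + a + t * fine (\int[P x]_y (f y)%:E))%:E)%E.
Proof.
move=> mf f01; have If : (P x).-integrable setT (EFin \o f).
  exact: (integrable_bounded01 (prob_kernel x)).
have IE := integrable_E x.
have Ia : (P x).-integrable setT (EFin \o cst a).
  exact: (integrable_cst_probability _ (prob_kernel x)).
have IsE : (P x).-integrable setT (fun y => s%:E * (E y)%:E)%E.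
  exact: integrableZl.
have Itf : (P x).-integrable setT (fun y => t%:E * (f y)%:E)%E.
  exact: integrableZl.
under eq_integral do rewrite !EFinD !EFinM.
rewrite integralD//=; last exact: integrableD.
rewrite integralD// !integralZl// (integral_cst_probability _ (prob_kernel x)).
by rewrite !EFinD !EFinM !fineK//; exact: integrable_fin_num.
Qed.

(* With W = 1 + b E and k = inf (s W - phi), both s W - phi - k and s W + phi + k
   are nonnegative, so that the mass eta common to P x and P y can be discarded
   from the integral of the former under P x and of the latter under P y. *)
Lemma markov_op_overlap (phi : T -> R) (b s eps : R) x y
    (eta : {measure set T -> \bar R}) :
  measurable_fun setT phi -> (forall u, 0 <= phi u <= 1) ->
  0 <= b -> 0 <= s ->
  (forall u v, phi u - phi v <= s * (2 + b * E u + b * E v)) ->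
  0 <= eps -> (eps%:E <= eta setT)%E ->
  (forall A, measurable A -> (eta A <= P x A)%E) ->
  (forall A, measurable A -> (eta A <= P y A)%E) ->
  fine (\int[P x]_u (phi u)%:E)%E - fine (\int[P y]_u (phi u)%:E)%E <=
  s * (2 + b * (gamma * E x + c) + b * (gamma * E y + c) - 2 * eps).
Proof.
move=> mphi phi01 b0 s0 lip eps0 eta_eps etax etay.
pose S := [set s * (1 + b * E u) - phi u | u in setT].
have S_lb v : lbound S (- (s * (1 + b * E v) + phi v)).
  by move=> _ [u _ <-]; have := lip u v; lra.
have S_inf : has_inf S.
  by split; [exists (s * (1 + b * E x) - phi x), x|eexists; exact: (S_lb x)].
pose k := inf S.
have w1_ge0 u : 0 <= s * b * E u + (s - k) + (-1) * phi u.
  have : k <= s * (1 + b * E u) - phi u by apply: ge_inf; [case: S_inf|exists u].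
  by lra.
have w2_ge0 u : 0 <= s * b * E u + (s + k) + 1 * phi u.
  have : - (s * (1 + b * E u) + phi u) <= k.
    by apply: lb_le_inf; [case: S_inf|exact: S_lb].
  by lra.
have mw (a t : R) : measurable_fun setT
    (fun u => (s * b * E u + a + t * phi u)%:E).
  apply/measurable_EFinP; apply: measurable_funD.
    by apply: measurable_funD => //; exact: measurable_funM.
  exact: measurable_funM.
have h1 : (\int[eta]_u (s * b * E u + (s - k) + (-1) * phi u)%:E <=
           \int[P x]_u (s * b * E u + (s - k) + (-1) * phi u)%:E)%E.
  by apply: ge0_le_measure_integral => // u; rewrite lee_fin.
have h2 : (\int[eta]_u (s * b * E u + (s + k) + 1 * phi u)%:E <=
           \int[P y]_u (s * b * E u + (s + k) + 1 * phi u)%:E)%E.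
  by apply: ge0_le_measure_integral => // u; rewrite lee_fin.
(* The two integrands add up to [2 * s * (1 + b * E u)], at least [2 * s]: [phi] and [k] cancel. *)
have h3 : ((2 * s * eps)%:E <= \int[eta]_u (s * b * E u + (s - k) + (-1) * phi u)%:E +
    \int[eta]_u (s * b * E u + (s + k) + 1 * phi u)%:E)%E.
  rewrite -ge0_integralD//; last 2 first.
  - by move=> u _; rewrite lee_fin.
  - by move=> u _; rewrite lee_fin.
  apply: (@le_trans _ _ (\int[eta]_u (cst (2 * s)%:E u))%E).
    rewrite integral_cst// EFinM lee_pmul//.
      by rewrite lee_fin mulr_ge0.
  apply: ge0_le_integral => //.
  - by move=> u _; rewrite lee_fin mulr_ge0.
  - exact: emeasurable_funD.
  - move=> u _; rewrite -EFinD lee_fin.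
    have : 0 <= s * b * E u by rewrite !mulr_ge0.
    lra.
have := le_trans h3 (leeD h1 h2).
rewrite !integral_affine// -EFinD lee_fin.
have drift_fine z : fine (\int[P z]_y (E y)%:E)%E <= gamma * E z + c.
  by rewrite -lee_fin fineK//; exact: integrable_fin_num.
have sb0 : 0 <= s * b by rewrite mulr_ge0.
have := ler_wpM2l sb0 (drift_fine x); have := ler_wpM2l sb0 (drift_fine y).
lra.
Qed.

Hypothesis minor : forall a, exists2 eta : {measure set T -> \bar R},
  (0 < eta setT)%E &
  forall x, E x <= a -> forall A, measurable A -> (eta A <= P x A)%E.

(** Pairs are split at [E x + E y = a]. Below, the common mass gains [2 eps] while the drift
    constants cost [2 b c = eps]. Above, the drift alone gains [(1 - gamma) b (E x + E y)], at least
    [4 b c = 2 eps], against the same cost. *)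
Lemma markov_op_contraction : exists b rho : R, [/\ 0 < b, 0 < rho < 1 &
  forall (phi : T -> R) s, measurable_fun setT phi ->
    (forall u, 0 <= phi u <= 1) -> 0 <= s ->
    (forall u v, phi u - phi v <= s * (2 + b * E u + b * E v)) ->
    forall x y, fine (\int[P x]_u (phi u)%:E)%E - fine (\int[P y]_u (phi u)%:E)%E
      <= rho * s * (2 + b * E x + b * E y)].
Proof.
have /andP[g0 g1] := gamma01.
pose a := 4 * c / (1 - gamma).
have ga : (1 - gamma) * a = 4 * c.
  by rewrite /a mulrCA divff ?mulr1//; lra.
have [eta eta0 eta_le] := minor a.
(* [eta] may have infinite mass; [eps = 1] is taken then. *)
have [eps eps0 eps_le] : exists2 eps : R, 0 < eps & (eps%:E <= eta setT)%E.
  move: eta0; case: (eta setT) => [r|_|//].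
    by rewrite lte_fin => r0; exists r.
  by exists 1 => //; rewrite leey.
pose b := eps / (2 * c).
have bc : b * c = eps / 2 by rewrite /b; field; rewrite gt_eqF.
have b0 : 0 < b by rewrite divr_gt0// mulr_gt0.
(* The tight case is [E x + E y > a]: a quarter of the gain pays for [delta * (b * E x + b * E y)],
   and the remaining [3 eps / 2] or more covers the cost [eps] and [2 delta <= eps / 2]. *)
pose delta := Num.min (eps / 4) ((1 - gamma) / 4).
have d0 : 0 < delta by rewrite lt_min !divr_gt0// subr_gt0.
have d1 : delta <= eps / 4 by rewrite ge_min lexx.
have d2 : delta <= (1 - gamma) / 4 by rewrite ge_min lexx orbT.
exists b, (1 - delta); split => //; first by lra.
move=> phi s mphi phi01 s0 lip x y.
rewrite (mulrC (1 - delta)) -mulrA.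
have bE z : 0 <= b * E z by rewrite mulr_ge0// ltW.
have dE : delta * (b * E x + b * E y) <= (1 - gamma) / 4 * (b * E x + b * E y).
  by rewrite ler_wpM2r// addr_ge0.
have [Ea|Ea] := lerP (E x + E y) a.
  have Ex : E x <= a by have := E0 y; lra.
  have Ey : E y <= a by have := E0 x; lra.
  apply: (le_trans (@markov_op_overlap phi b s eps x y eta mphi phi01
    (ltW b0) s0 lip (ltW eps0) eps_le (eta_le x Ex) (eta_le y Ey))).
  apply: ler_wpM2l => //.
  have := ler_wpM2r (bE x) (ltW g1); have := ler_wpM2r (bE y) (ltW g1).
  have := bE x; have := bE y; lra.
(* Above the threshold the overlap bound is used with the zero measure and [eps = 0], which leaves
   the bare drift estimate. *)
have mzle z A : measurable A -> ((mzero : {measure set T -> \bar R}) A <= P z A)%E.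
  by move=> _; exact: measure_ge0.
apply: (le_trans (@markov_op_overlap phi b s 0 x y mzero mphi phi01
  (ltW b0) s0 lip (lexx 0) (lexx _) (mzle x) (mzle y))).
apply: ler_wpM2l => //.
have : b * ((1 - gamma) * a) <= b * ((1 - gamma) * (E x + E y)).
  by apply: ler_wpM2l; [exact: ltW|apply: ler_wpM2l; [lra|exact: ltW]].
rewrite ga; have := bE x; have := bE y; lra.
Qed.

End harris_contraction.

(** * Harris' theorem for a family of chains *)

Section harris_theorem.
Context d (T : measurableType d) (R : realType).
Variables (P : R.-pker T ~> T) (E : T -> R) (gamma c : R).
Hypotheses (mE : measurable_fun setT E) (E0 : forall x, 0 <= E x).
Hypotheses (gamma01 : 0 < gamma < 1) (c0 : 0 < c).
Hypothesis drift : forall x, (\int[P x]_y (E y)%:E <= (gamma * E x + c)%:E)%E.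
Hypothesis minor : forall a, exists2 eta : {measure set T -> \bar R},
  (0 < eta setT)%E &
  forall x, E x <= a -> forall A, measurable A -> (eta A <= P x A)%E.

(** Only the sequence of laws is recorded, so that the constant sequence at an invariant law is a
    chain too. *)
Definition markov_chain (m : nat -> probability T R) :=
  forall n A, measurable A -> m n.+1 A = (\int[m n]_x P x A)%E.

Fixpoint iter_ker n (A : set T) (x : T) : R :=
  if n is n'.+1 then fine (\int[P x]_y (iter_ker n' A y)%:E)%E else \1_A x.

Let measurable_iter_ker01 n A : measurable A ->
  measurable_fun setT (iter_ker n A) /\ forall x, 0 <= iter_ker n A x <= 1.
Proof.
move=> mA; elim: n => [|n [mi i01]] /=.
  split; first exact: measurable_indic.
  by move=> x; rewrite indicE; case: (_ \in _) => /=; rewrite !lexx ler01.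
split.
  apply: measurableT_comp; first exact: fine_measurable.
  apply: measurable_fun_integral_kernel.
  - by move=> U mU; exact: measurable_kernel.
  - by move=> x; rewrite lee_fin; case/andP: (i01 x).
  - exact/measurable_EFinP.
move=> x; have /andP[h0 h1] := integral_bounded01 (prob_kernel (s := P) x) mi i01.
have hf : (\int[P x]_y (iter_ker n A y)%:E)%E \is a fin_num.
  by rewrite ge0_fin_numE// (le_lt_trans h1)// ltry.
by rewrite fine_ge0//= -lee_fin fineK.
Qed.

Let measurable_iter_ker n A : measurable A -> measurable_fun setT (iter_ker n A).
Proof. by move=> mA; case: (measurable_iter_ker01 n mA). Qed.

Let iter_ker01 n A : measurable A -> forall x, 0 <= iter_ker n A x <= 1.
Proof. by move=> mA; case: (measurable_iter_ker01 n mA). Qed.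

(** The induction is over all chains at once: it applies to the chain shifted by one step, and the
    first step is absorbed into the iterated kernel. *)
Let iter_ker_chain m n A : markov_chain m -> measurable A ->
  m n A = (\int[m 0%N]_x (iter_ker n A x)%:E)%E.
Proof.
move=> + mA; elim: n m => [|n IHn] m chain_m /=.
  by rewrite integral_indic// setIT.
rewrite (IHn (fun k => m k.+1)); last by move=> k B mB; exact: chain_m.
rewrite (ge0_integral_mixture (mu := m 0%N) (k := P)); last 3 first.
- by move=> B mB; exact: chain_m.
- by move=> x; rewrite lee_fin; case/andP: (iter_ker01 n mA x).
- exact/measurable_EFinP/measurable_iter_ker.
apply: eq_integral => x _.
have /andP[h0 h1] := integral_bounded01 (prob_kernel (s := P) x)
  (measurable_iter_ker n mA) (iter_ker01 n mA).
by rewrite fineK// ge0_fin_numE// (le_lt_trans h1)// ltry.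
Qed.

Let ge0_integral_affine_le (mu : probability T R) s k b M :
  0 <= s -> 0 <= k -> 0 <= b -> (\int[mu]_x (E x)%:E <= M%:E)%E ->
  (\int[mu]_x (s * (k + b * E x))%:E <= (s * (k + b * M))%:E)%E.
Proof.
move=> s0 k0 b0 EM.
under eq_integral do rewrite EFinM EFinD EFinM.
have mEE : measurable_fun setT (fun x => (E x)%:E) by exact/measurable_EFinP.
have mbE : measurable_fun setT (fun x => b%:E * (E x)%:E)%E.
  exact: measurable_funeM.
have bE0 x : (0 <= b%:E * (E x)%:E)%E by rewrite mule_ge0// lee_fin.
rewrite ge0_integralZl//; last 2 first.
- exact: emeasurable_funD.
- by move=> x _; rewrite adde_ge0// lee_fin.
rewrite EFinM lee_wpmul2l// ge0_integralD//.
rewrite (integral_cst_probability _ (probability_setT mu)) EFinD leeD//.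
rewrite ge0_integralZl//; last by move=> x _; rewrite lee_fin.
by rewrite EFinM lee_wpmul2l.
Qed.

Let chain_drift m M : markov_chain m -> 0 <= M ->
  (\int[m 0%N]_x (E x)%:E <= M%:E)%E ->
  forall n, (\int[m n]_x (E x)%:E <= (M + c / (1 - gamma))%:E)%E.
Proof.
have /andP[g0 g1] := gamma01.
have c1 : 0 <= c / (1 - gamma) by rewrite divr_ge0 ?ltW// subr_gt0.
(* [c / (1 - gamma)] is the fixed point of the drift recursion. *)
have cE : gamma * (c / (1 - gamma)) + c = c / (1 - gamma).
  by field; rewrite gt_eqF// subr_gt0.
move=> chain_m M0 mM; elim=> [|n IHn].
  by apply: (le_trans mM); rewrite lee_fin lerDl.
rewrite (ge0_integral_mixture (mu := m n) (k := P)); last 3 first.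
- by move=> A mA; exact: chain_m.
- by move=> x; rewrite lee_fin.
- exact/measurable_EFinP.
apply: (@le_trans _ _ (\int[m n]_x (1 * (c + gamma * E x))%:E)%E).
  apply: ge0_le_integral => //.
  - by move=> x _; apply: integral_ge0 => y _; rewrite lee_fin.
  - apply: measurable_fun_integral_kernel.
    + by move=> U mU; exact: measurable_kernel.
    + by move=> x; rewrite lee_fin.
    + exact/measurable_EFinP.
  - apply/measurable_EFinP; apply: measurable_funM => //.
    by apply: measurable_funD => //; exact: measurable_funM.
  - by move=> x _; rewrite mul1r addrC.
apply: (le_trans (ge0_integral_affine_le ler01 (ltW c0) (ltW g0) IHn)).
rewrite lee_fin mul1r mulrDr.
have : gamma * M <= M by rewrite ler_piMl// ltW.
by move: cE; lra.
Qed.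

Lemma harris (x0 : T) (law : probability T R -> nat -> probability T R)
    (law0 : forall mu A, measurable A -> law mu 0%N A = mu A)
    (lawS : forall mu, markov_chain (law mu)) :
  exists pi : probability T R,
    [/\ forall A, measurable A -> (\int[pi]_x P x A = pi A)%E,
        forall pi' : probability T R,
          (forall A, measurable A -> (\int[pi']_x P x A = pi' A)%E) ->
          forall A, measurable A -> pi' A = pi A &
        exists r kappa : R, [/\ 0 < r < 1, 0 < kappa &
          forall (mu : probability T R) (n : nat),
            (tv_dist (law mu n) pi
              <= (kappa * r ^+ n)%:E * (1 + \int[mu]_x (E x)%:E))%E]].
Proof.
have [b [rho [b0 /andP[rho0 rho1] contract]]] :=
  markov_op_contraction mE E0 gamma01 c0 drift minor.
have rhon0 n : 0 <= rho ^+ n by rewrite exprn_ge0// ltW.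
(* At time 0 values lie in [0, 1] and the weight is at least 2; each further step is the contraction
   with [s = rho ^+ n]. *)
have osc n A : measurable A -> forall x y,
    iter_ker n A x - iter_ker n A y <= rho ^+ n * (2 + b * E x + b * E y).
  move=> mA; elim: n => [|n IHn] x y.
    have /andP[? ?] := iter_ker01 0 mA x; have /andP[? ?] := iter_ker01 0 mA y.
    have : 0 <= b * E x by rewrite mulr_ge0// ltW.
    have : 0 <= b * E y by rewrite mulr_ge0// ltW.
    by rewrite expr0 mul1r; lra.
  by rewrite exprS; apply: contract => //; [exact: measurable_iter_ker|exact: iter_ker01].
have osc_norm n A x y : measurable A ->
    `|iter_ker n A x - iter_ker n A y| <= rho ^+ n * ((2 + b * E y) + b * E x).
  move=> mA; have := osc n A mA x y; have := osc n A mA y x.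
  by rewrite ler_norml => ? ?; apply/andP; split; lra.
have mW n (k : R) : measurable_fun setT (fun x => rho ^+ n * (k + b * E x)).
  apply: measurable_funM => //; apply: measurable_funD => //.
  exact: measurable_funM.
have law_int mu n A : measurable A ->
    law mu n A = (\int[mu]_x (iter_ker n A x)%:E)%E.
  move=> mA; rewrite (iter_ker_chain _ (lawS mu))//.
  by apply: eq_measure_integral => B mB _; exact: law0.
have /andP[g0 g1] := gamma01.
have c1 : 0 <= c / (1 - gamma) by rewrite divr_ge0 ?ltW// subr_gt0.
pose m := law [the probability T R of \d_x0].
pose M := E x0 + c / (1 - gamma).
have M0 : 0 <= M by rewrite addr_ge0.
have m_le n : (\int[m n]_x (E x)%:E <= M%:E)%E.
  apply: chain_drift => //; first exact: lawS.
  rewrite (eq_measure_integral [the measure _ _ of \d_x0]); last first.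
    by move=> A mA _; exact: law0.
  rewrite integral_dirac//; first by rewrite diracT mul1e.
  exact/measurable_EFinP.
have mE' n A : measurable A -> fine (m n A) = iter_ker n A x0.
  move=> mA; rewrite /m law_int// integral_dirac//.
    by rewrite diracT mul1e.
  exact/measurable_EFinP/measurable_iter_ker.
have [pi m_pi] : exists pi : probability T R, forall n A, measurable A ->
    `|fine (m n A) - fine (pi A)| <= rho ^+ n * ((2 + b * E x0) + b * M).
  apply: (@setwise_cauchy_limit _ _ _ m
    (fun n => rho ^+ n * ((2 + b * E x0) + b * M))).
    rewrite -[X in _ --> X](mul0r ((2 + b * E x0) + b * M)).
    by apply: cvgMl; apply: cvg_expr; rewrite ger0_norm// ltW.
  (* At time [k + n] the law averages [iter_ker n A] over [m k]. Each value is compared with the one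
     at [x0], and the mean of [E] under [m k] is at most [M] for every [k]. *)
  move=> n k A mA; rewrite (mE' n)// addnC.
  have -> : m (k + n)%N A = (\int[m k]_x (iter_ker n A x)%:E)%E.
    rewrite addnC; apply: (iter_ker_chain (m := fun j => m (j + k)%N)) => //.
    by move=> j B mB; exact: lawS.
  apply: (dist_integral_le (probability_setT (m k)) _ _ (mW n (2 + b * E x0))).
  - exact: measurable_iter_ker.
  - exact: iter_ker01.
  - by move=> x; exact: osc_norm.
  - apply: ge0_integral_affine_le => //; last exact: ltW.
    by rewrite addr_ge0// mulr_ge0// ltW.
have m_cvg A : measurable A -> m n A @[n --> \oo] --> pi A.
  move=> mA; rewrite -[pi A]fineK ?fin_num_measure//.
  apply: cvg_EFin; first by apply: nearW => n; exact: fin_num_measure.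
  apply/cvgrPdist_lt => eps eps0.
  have : rho ^+ n * ((2 + b * E x0) + b * M) @[n --> \oo] --> 0.
    rewrite -[X in _ --> X](mul0r ((2 + b * E x0) + b * M)).
    by apply: cvgMl; apply: cvg_expr; rewrite ger0_norm// ltW.
  move=> /cvgrPdist_lt/(_ _ eps0); apply: filterS => n /=.
  rewrite sub0r normrN => /(le_lt_trans (ler_norm _)); apply: le_lt_trans.
  by rewrite distrC; exact: m_pi.
have inv_le A : measurable A -> (\int[pi]_x P x A <= pi A)%E.
  move=> mA; rewrite -[X in (_ <= X)%E]fineK ?fin_num_measure//.
  apply: (@ge0_integral_setwise_limit_le _ _ _ m pi _ (fun n => fine (m n.+1 A))) => //.
  - exact: measurable_kernel.
  - by move=> n; rewrite fineK ?fin_num_measure// -lawS.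
  - have := m_cvg A mA; rewrite -[X in _ --> X]fineK ?fin_num_measure//.
    by move=> /fine_cvg; rewrite -(cvg_shiftn 1); under eq_fun do rewrite /= addn1.
(* Passing to the limit gives only an inequality; the same inequality for the complement, with total
   mass 1 on both sides, forces equality. *)
have inv A : measurable A -> (\int[pi]_x P x A = pi A)%E.
  move=> mA; apply/eqP; rewrite eq_le inv_le//=.
  have mAC : measurable (~` A) by exact: measurableC.
  have fin B : measurable B -> (\int[pi]_x P x B)%E \is a fin_num.
    move=> mB; rewrite ge0_fin_numE; last by apply: integral_ge0.
    by rewrite (le_lt_trans (inv_le B mB))// ltey_eq fin_num_measure.
  have sum1 : (\int[pi]_x P x A + \int[pi]_x P x (~` A) = 1)%E.
    rewrite -ge0_integralD//; try exact: measurable_kernel.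
    rewrite (eq_integral (cst 1%E)); last first.
      move=> x _; rewrite -measureU//; last by rewrite setICr.
      by rewrite setUv; exact: prob_kernel.
    exact: (integral_cst_probability _ (probability_setT pi)).
  have := inv_le _ mAC; rewrite probability_setC//.
  rewrite -(fineK (fin _ mA)) -(fineK (fin _ mAC)) -[pi A]fineK ?fin_num_measure//.
  move: sum1; rewrite -(fineK (fin _ mA)) -(fineK (fin _ mAC)) -EFinD => -[].
  by rewrite -EFinB !lee_fin => ? ?; lra.
have pi_M : (\int[pi]_x (E x)%:E <= M%:E)%E.
  apply: (@ge0_integral_setwise_limit_le _ _ _ m pi _ (fun=> M)) => //.
  - exact/measurable_EFinP.
  - exact: cvg_cst.
(* As [pi] is a constant chain, [pi A] is the mean of [iter_ker n A] under [pi], and [pi_M] bounds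
   the averaged weight. *)
have iter_pi n A x : measurable A ->
    `|iter_ker n A x - fine (pi A)| <= rho ^+ n * ((2 + b * M) + b * E x).
  move=> mA; rewrite (iter_ker_chain (m := fun=> pi) n _ mA); last first.
    by move=> k B mB; rewrite inv.
  rewrite distrC.
  have -> : (2 + b * M) + b * E x = (2 + b * E x) + b * M by rewrite addrAC.
  apply: (dist_integral_le (probability_setT pi) _ _ (mW n (2 + b * E x))).
  - exact: measurable_iter_ker.
  - exact: iter_ker01.
  - by move=> y; exact: osc_norm.
  - apply: ge0_integral_affine_le => //; last exact: ltW.
    by rewrite addr_ge0// mulr_ge0// ltW.
exists pi; split => //.
  move=> pi' inv' A mA.
  (* [pi'] is not known to integrate [E], so the weighted bound is used pointwise and dominated
     convergence concludes. *)
  have pi'E n : pi' A = (\int[pi']_x (iter_ker n A x)%:E)%E.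
    by apply: (iter_ker_chain (m := fun=> pi')) => // k B mB; rewrite inv'.
  have iter_cvg x : setT x -> (iter_ker n A x)%:E @[n --> \oo] --> pi A.
    move=> _; rewrite -[pi A]fineK ?fin_num_measure//.
    apply: cvg_EFin; first exact: nearW.
    apply/cvgrPdist_lt => eps eps0.
    have : rho ^+ n * ((2 + b * M) + b * E x) @[n --> \oo] --> 0.
      rewrite -[X in _ --> X](mul0r ((2 + b * M) + b * E x)).
      by apply: cvgMl; apply: cvg_expr; rewrite ger0_norm// ltW.
    move=> /cvgrPdist_lt/(_ _ eps0); apply: filterS => n /=.
    rewrite sub0r normrN => /(le_lt_trans (ler_norm _)); apply: le_lt_trans.
    by rewrite distrC; exact: iter_pi.
  have [] := @dominated_convergence _ _ _ pi' setT measurableT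
    (fun n x => (iter_ker n A x)%:E) (cst (pi A)) (cst 1%E).
  - by move=> n; exact/measurable_EFinP/measurable_iter_ker.
  - exact: measurable_cst.
  - exact: aeW.
  - exact: (integrable_cst_probability 1 (probability_setT pi')).
  - apply: aeW => x n _; rewrite abse_EFin lee_fin.
    by have /andP[? ?] := iter_ker01 n mA x; rewrite ger0_norm.
  move=> _ _; rewrite (integral_cst_probability _ (probability_setT pi')).
  rewrite (_ : [sequence _]_n = cst (pi' A)); last first.
    by apply/funext => n; rewrite /= -pi'E.
  by move=> /(cvg_unique _ (cvg_cst _)) ->.
have bM0 : 0 <= b * M by rewrite mulr_ge0// ltW.
(* This constant makes [(2 + b * M) + b * F] at most [kappa * (1 + F)], with [F] the mean of [E]. *)
exists rho, (2 + b * M + b); split; rewrite ?rho0//.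
  by lra.
move=> mu n; apply: ge_ereal_sup => _ [A mA <-].
have kr0 : 0 < (2 + b * M + b) * rho ^+ n.
  by rewrite mulr_gt0 ?exprn_gt0//; lra.
(* If [E] has infinite mean, the bound is infinite because [kappa * r ^+ n] is positive. *)
have [Eoo|Efin] := eqVneq (\int[mu]_x (E x)%:E)%E +oo%E.
  by rewrite Eoo addey// gt0_muley ?lte_fin// leey.
have {}Efin : (\int[mu]_x (E x)%:E)%E \is a fin_num.
  by rewrite ge0_fin_numE ?lt_neqAle ?Efin ?leey// integral_ge0// => x _; rewrite lee_fin.
have EF := fineK Efin; set F := fine _ in EF; rewrite -EF.
have F0 : 0 <= F by apply: fine_ge0; apply: integral_ge0 => x _; rewrite lee_fin.
rewrite -EFinD -EFinM -[law mu n A]fineK ?fin_num_measure//.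
rewrite -[pi A]fineK ?fin_num_measure// -EFinB abse_EFin lee_fin.
rewrite law_int//.
apply: (@le_trans _ _ (rho ^+ n * ((2 + b * M) + b * F))).
  apply: (dist_integral_le (probability_setT mu) _ _ (mW n (2 + b * M))).
  - exact: measurable_iter_ker.
  - exact: iter_ker01.
  - by move=> x; exact: iter_pi.
  - apply: ge0_integral_affine_le => //.
    + by rewrite addr_ge0.
    + exact: ltW.
    + by rewrite -EF.
rewrite (mulrC _ (rho ^+ n)) -mulrA ler_wpM2l//.
have : 0 <= (b * M) * F by rewrite mulr_ge0.
move: bM0 F0 (ltW b0); lra.
Qed.

End harris_theorem.

(** * Borel sets of matrix spaces and of their products *)

Lemma open_bigcup_ball (R : realType) (X : pseudoMetricType R) (D : nat -> X)
    (A : set X) :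
  (forall x e, 0 < e -> exists i, ball (D i) e x) -> open A ->
  A = \bigcup_i \bigcup_(n in [set n | ball (D i) n.+1%:R^-1 `<=` A])
        ball (D i) n.+1%:R^-1.
Proof.
move=> denseD; rewrite openE => oA; apply/seteqP; split => [x Ax|]; last first.
  by move=> x [i _ [n /= + Dx]]; apply.
have /nbhs_ballP[e /= e0 eA] := oA _ Ax.
have [n ne] : exists n, n.+1%:R^-1 < e / 2.
  have := near_infty_natSinv_lt (PosNum (divr_gt0 e0 (ltr0n R 2))).
  by case=> n _ /(_ n (leqnn n)); exists n.
have n0 : 0 < n.+1%:R^-1 :> R by rewrite invr_gt0.
have [i Dx] := denseD x _ n0.
exists i => //; exists n => //= y Dy; apply: eA.
rewrite (splitr e); apply: (@ball_triangle _ _ (D i)).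
  by apply: ball_sym; apply: le_ball Dx; exact: ltW.
by apply: le_ball Dy; exact: ltW.
Qed.

Section matrix_borel.
Context (R : realType) (m n : nat).

(** Enumerates the rational matrices by their codes; a number that codes none gives 0. *)
Definition ratr_mx (k : nat) : 'M[R]_(m, n) :=
  if unpickle k is Some c then map_mx ratr (c : 'M[rat]_(m, n)) else 0.

Lemma ratr_mx_dense (x : 'M[R]_(m, n)) e : 0 < e ->
  exists k, ball (ratr_mx k) e x.
Proof.
move=> e0.
have h i j : {q : rat | `|ratr q - x i j| < e}.
  have /rat_in_itvoo/cid[q] : x i j - e < x i j + e by lra.
  rewrite in_itv /= => /andP[? ?]; exists q.
  by rewrite ltr_norml; apply/andP; split; lra.
exists (pickle (\matrix_(i, j) sval (h i j))).
rewrite /ratr_mx pickleK; split => // i j; rewrite !mxE.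
by case: (h i j).
Qed.

Lemma open_measurable_mx (A : set 'M[R]_(m, n)) : open A -> measurable A.
Proof. exact: sub_sigma_algebra. Qed.

Lemma measurable_mx_entry i j :
  measurable_fun setT (fun A : 'M[R]_(m, n) => A i j).
Proof.
apply: (measurability _ (RGenOInfty.measurableE R)) => _ [_ [a ->] <-].
rewrite setTI; apply: open_measurable_mx; apply: open_comp => //.
by move=> A _; exact: coord_continuous.
Qed.

Lemma mx_ball_bigcap (x : 'M[R]_(m, n)) e : 0 < e ->
  ball x e = \bigcap_(i in [set: 'I_m]) \bigcap_(j in [set: 'I_n])
    (fun y : 'M[R]_(m, n) => y i j) @^-1` ball (x i j) e.
Proof.
move=> e0; apply/seteqP; split => [y [_ xy] i _ j _|y xy]; first exact: xy.
by split => // i j; exact: xy.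
Qed.

Lemma measurable_mx_ball (x : 'M[R]_(m, n)) e : 0 < e -> measurable (ball x e).
Proof.
move=> e0; rewrite mx_ball_bigcap//.
apply: fin_bigcap_measurable => // i _; apply: fin_bigcap_measurable => // j _.
rewrite -[X in measurable X]setTI; apply: measurable_mx_entry => //.
exact: measurable_ball.
Qed.

(** Open sets are countable unions of balls with rational centres, and balls of the sup norm are
    boxes, that is, finitely many conditions on entries. *)
Lemma measurable_mxP d (S : measurableType d) (f : S -> 'M[R]_(m, n)) :
  measurable_fun setT f <-> forall i j, measurable_fun setT (fun s => f s i j).
Proof.
split=> [mf i j|mf].
  exact: (measurableT_comp (measurable_mx_entry i j) mf).
apply: (@measurability _ _ _ 'M[R]_(m, n) _ f (@open 'M[R]_(m, n))) => //.
move=> _ [A oA <-]; rewrite setTI.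
rewrite (open_bigcup_ball ratr_mx_dense oA) preimage_bigcup.
apply: bigcupT_measurable => i; rewrite preimage_bigcup.
apply: bigcup_measurable => k _.
rewrite mx_ball_bigcap ?invr_gt0// preimage_bigcap.
apply: fin_bigcap_measurable => // i' _; rewrite preimage_bigcap.
apply: fin_bigcap_measurable => // j _.
rewrite -comp_preimage -[X in measurable X]setTI; apply: mf => //.
exact: measurable_ball.
Qed.

End matrix_borel.

(** The product carries the product sigma-algebra. It contains the open sets because pairs of
    rational matrices are dense and balls of the product are rectangles. *)
Lemma open_measurable_mx_prod (R : realType) m n p q
    (A : set ('M[R]_(m, n) * 'M[R]_(p, q))) : open A -> measurable A.
Proof.
pose D k : 'M[R]_(m, n) * 'M[R]_(p, q) :=
  if unpickle k is Some (i, j) then (ratr_mx R m n i, ratr_mx R p q j) else 0.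
have denseD x e : 0 < e -> exists k, ball (D k) e x.
  move=> e0; have [i xi] := ratr_mx_dense x.1 e0.
  have [j xj] := ratr_mx_dense x.2 e0.
  by exists (pickle (i, j)); rewrite /D pickleK.
move=> oA; rewrite (open_bigcup_ball denseD oA).
apply: bigcupT_measurable => i; apply: bigcup_measurable => k _.
rewrite (_ : ball _ _ = ball (D i).1 k.+1%:R^-1 `*` ball (D i).2 k.+1%:R^-1)//.
by apply: measurableX; exact: measurable_mx_ball.
Qed.

(** Compact sets are closed here, so the sub-level sets of [E] are Borel. *)
Lemma measurable_compact_sublevel (R : realType) m n p q
    (E : 'M[R]_(m, n) * 'M[R]_(p, q) -> R) :
  (forall a, compact [set x | E x <= a]) -> measurable_fun setT E.
Proof.
move=> cE; apply: (measurability _ (RGenOInfty.measurableE R)) => _ [_ [a ->] <-].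
rewrite setTI (_ : _ @^-1` _ = ~` [set x | E x <= a]); last first.
  by apply/seteqP; split => x /=; rewrite in_itv /= andbT ltNge => /negP.
apply: measurableC; rewrite -[X in measurable X]setCK; apply: measurableC.
apply: open_measurable_mx_prod; rewrite openC.
exact: (compact_closed (@norm_hausdorff _ _) (cE a)).
Qed.

(** * Measurability of matrix operations and of the analysis map *)

Section measurable_matrix_ops.
Context d (S : measurableType d) (R : realType).

Lemma measurable_mxE m n (f : S -> 'M[R]_(m, n)) i j :
  measurable_fun setT f -> measurable_fun setT (fun s => f s i j).
Proof. by move=> /measurable_mxP. Qed.

Lemma measurable_addmx m n (f g : S -> 'M[R]_(m, n)) :
  measurable_fun setT f -> measurable_fun setT g ->
  measurable_fun setT (fun s => f s + g s).
Proof.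
move=> mf mg; apply/measurable_mxP => i j; under eq_fun do rewrite mxE.
by apply: measurable_funD; exact: measurable_mxE.
Qed.

Lemma measurable_scalemx m n (h : S -> R) (f : S -> 'M[R]_(m, n)) :
  measurable_fun setT h -> measurable_fun setT f ->
  measurable_fun setT (fun s => h s *: f s).
Proof.
move=> mh mf; apply/measurable_mxP => i j; under eq_fun do rewrite mxE.
by apply: measurable_funM => //; exact: measurable_mxE.
Qed.

Lemma measurable_submx m n (f g : S -> 'M[R]_(m, n)) :
  measurable_fun setT f -> measurable_fun setT g ->
  measurable_fun setT (fun s => f s - g s).
Proof.
move=> mf mg; apply/measurable_mxP => i j; under eq_fun do rewrite !mxE.
by apply: measurable_funB; exact: measurable_mxE.
Qed.

Lemma measurable_summx (I : Type) (s : seq I) m n (f : I -> S -> 'M[R]_(m, n)) :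
  (forall i, measurable_fun setT (f i)) ->
  measurable_fun setT (fun x => \sum_(i <- s) f i x).
Proof.
move=> mf; apply/measurable_mxP => i j; under eq_fun do rewrite summxE.
by apply: measurable_sum => k; exact: measurable_mxE.
Qed.

Lemma measurable_mulmx m n p (f : S -> 'M[R]_(m, n)) (g : S -> 'M[R]_(n, p)) :
  measurable_fun setT f -> measurable_fun setT g ->
  measurable_fun setT (fun s => f s *m g s).
Proof.
move=> mf mg; apply/measurable_mxP => i j; under eq_fun do rewrite mxE.
by apply: measurable_sum => k; apply: measurable_funM; exact: measurable_mxE.
Qed.

Lemma measurable_trmx m n (f : S -> 'M[R]_(m, n)) :
  measurable_fun setT f -> measurable_fun setT (fun s => (f s)^T).
Proof.
move=> mf; apply/measurable_mxP => i j; under eq_fun do rewrite mxE.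
exact: measurable_mxE.
Qed.

Lemma measurable_col m n (f : S -> 'M[R]_(m, n)) k :
  measurable_fun setT f -> measurable_fun setT (fun s => col k (f s)).
Proof.
move=> mf; apply/measurable_mxP => i j; under eq_fun do rewrite mxE.
exact: measurable_mxE.
Qed.

Lemma measurable_col_mx m n p (f : S -> 'M[R]_(m, p)) (g : S -> 'M[R]_(n, p)) :
  measurable_fun setT f -> measurable_fun setT g ->
  measurable_fun setT (fun s => col_mx (f s) (g s)).
Proof.
move=> mf mg; apply/measurable_mxP => i j; under eq_fun do rewrite mxE.
by case: splitP => k _; exact: measurable_mxE.
Qed.

Lemma measurable_det n (f : S -> 'M[R]_n) :
  measurable_fun setT f -> measurable_fun setT (fun s => \det (f s)).
Proof.
move=> mf; rewrite /determinant; apply: measurable_sum => t.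
apply: measurable_funM => //; apply: measurable_prod => i _.
exact: measurable_mxE.
Qed.

(** The inverse is [f * (f ^+ 2)^-1], where [powR] has a nonnegative base and is measurable; at 0
    both sides vanish since [0^-1 = 0]. *)
Lemma measurable_funV (f : S -> R) :
  measurable_fun setT f -> measurable_fun setT (fun s => (f s)^-1).
Proof.
move=> mf; rewrite (_ : (fun s => _) = (fun s => f s * (f s ^+ 2) `^ (-1))).
  apply: measurable_funM => //.
  apply: (@measurableT_comp _ _ _ _ _ _ (@powR R ^~ (-1))) => //.
  exact: measurable_funX.
apply/funext => s; rewrite powR_inv1 ?sqr_ge0// expr2.
by have [->|f0] := eqVneq (f s) 0; [rewrite invr0 mul0r|rewrite invfM mulVKf].
Qed.

(** Cofactor formula where the determinant is nonzero; elsewhere [invmx] returns its argument,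
    whence the case split. *)
Lemma measurable_invmx n (f : S -> 'M[R]_n) :
  measurable_fun setT f -> measurable_fun setT (fun s => invmx (f s)).
Proof.
move=> mf; have mdet := measurable_det mf.
rewrite (_ : (fun s => _) = (fun s => if \det (f s) == 0 then f s
    else (\det (f s))^-1 *: \adj (f s))); last first.
  by apply/funext => s; rewrite /invmx unitmxE unitfE if_neg.
apply: measurable_fun_ifT => //; first exact: measurable_fun_eqr.
apply: measurable_scalemx; first exact: measurable_funV.
apply/measurable_mxP => i j; under eq_fun do rewrite mxE /cofactor.
apply: measurable_funM => //; apply: measurable_det.
apply/measurable_mxP => k l; under eq_fun do rewrite !mxE.
exact: measurable_mxE.
Qed.

End measurable_matrix_ops.

Section measurable_enkf.
Context d0 (S : measurableType d0) (R : realType) (d q K : nat).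

Lemma measurable_ens_mean (W : S -> 'M[R]_(d, K)) :
  measurable_fun setT W -> measurable_fun setT (fun s => ens_mean (W s)).
Proof.
move=> mW; apply: measurable_scalemx => //.
by apply: measurable_summx => k; exact: measurable_col.
Qed.

Lemma measurable_ens_cov (W : S -> 'M[R]_(d, K)) :
  measurable_fun setT W -> measurable_fun setT (fun s => ens_cov (W s)).
Proof.
move=> mW; apply: measurable_scalemx => //.
have mc k : measurable_fun setT (fun s => col k (W s) - ens_mean (W s)).
  by apply: measurable_submx; [exact: measurable_col|exact: measurable_ens_mean].
by apply: measurable_summx => k; apply: measurable_mulmx => //; exact: measurable_trmx.
Qed.

Lemma measurable_kalman_gain (H : 'M[R]_(q, d)) (C : S -> 'M[R]_d) :
  measurable_fun setT C -> measurable_fun setT (fun s => kalman_gain H (C s)).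
Proof.
move=> mC; apply: measurable_mulmx.
  by apply: measurable_mulmx => //; exact: measurable_cst.
apply/measurable_invmx/measurable_addmx; first exact: measurable_cst.
apply: measurable_mulmx; last exact: measurable_cst.
by apply: measurable_mulmx => //; exact: measurable_cst.
Qed.

Lemma measurable_analysis (H : 'M[R]_(q, d)) (W : S -> 'M[R]_(d, K))
    (Z : S -> 'I_K -> 'cV[R]_q) :
  measurable_fun setT W -> (forall k, measurable_fun setT (Z ^~ k)) ->
  measurable_fun setT (fun s => analysis H (W s) (Z s)).
Proof.
move=> mW mZ; apply/measurable_mxP => i k; under eq_fun do rewrite mxE.
apply: (measurable_mxE (f := fun s =>
  col k (W s) - kalman_gain H (ens_cov (W s)) *m (H *m col k (W s) - Z s k))).
apply: measurable_submx; first exact: measurable_col.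
apply: measurable_mulmx.
  exact/measurable_kalman_gain/measurable_ens_cov.
apply: measurable_submx => //.
by apply: measurable_mulmx; [exact: measurable_cst|exact: measurable_col].
Qed.

End measurable_enkf.

(** * Image laws, translations and the uniform law on the unit box *)

Lemma exists_image_probability d d' (T : measurableType d) (S : measurableType d')
    (R : realType) (P : probability T R) (f : T -> S) :
  measurable_fun setT f ->
  exists Q : probability S R, forall A, Q A = P (f @^-1` A).
Proof.
move=> mf; pose X : {mfun T >-> S} := HB.pack f (isMeasurableFun.Build _ _ _ _ f mf).
by exists (distribution P X).
Qed.

Lemma lebesgue_measure_addr (R : realType) (a : R) (A : set R) : measurable A ->
  pushforward (@lebesgue_measure R)
    ((fun t => t + a) : _ -> measurableTypeR R) A = lebesgue_measure A.
Proof.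
have mf : measurable_fun [set: measurableTypeR R]
    ((fun t => t + a) : measurableTypeR R -> measurableTypeR R).
  by apply: measurable_funD.
move=> mA; apply/esym/lebesgue_measure_unique => //= _ [[x y]] _ <-.
rewrite /pushforward (_ : _ @^-1` _ = `]x - a, y - a]%classic); last first.
  by apply/seteqP; split => t /=; rewrite !in_itv /= => /andP[? ?];
    apply/andP; split; lra.
rewrite !lebesgue_measure_itv /= !lte_fin ltrD2r.
by case: ifP => // _; rewrite -!EFinB; congr EFin; lra.
Qed.

Lemma integral_lebesgue_addr (R : realType) (a : R) (f : R -> \bar R) :
  measurable_fun setT f -> (forall t, 0 <= f t)%E ->
  (\int[@lebesgue_measure R]_t f (t + a)%R = \int[@lebesgue_measure R]_t f t)%E.
Proof.
move=> mf f0.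
have ma : measurable_fun [set: measurableTypeR R]
    ((fun t => t + a) : measurableTypeR R -> measurableTypeR R).
  by apply: measurable_funD.
rewrite -[LHS]/(\int[lebesgue_measure]_(t in (fun t => t + a)%R @^-1` setT)
  (f \o (fun t => t + a)%R) t)%E.
rewrite -(ge0_integral_pushforward ma)//.
apply: eq_measure_integral => A mA _; exact: lebesgue_measure_addr.
Qed.

Section unit_box.
Variable R : realType.

Definition unit_box n : set 'cV[R]_n := [set x | forall i, 0 <= x i 0 <= 1].

Lemma unit_box_col_mx n (t : R) (w : 'cV[R]_n) :
  unit_box (col_mx (t%:M : 'cV[R]_1) w : 'cV[R]_n.+1) <->
  0 <= t <= 1 /\ unit_box w.
Proof.
split=> [h|[t01 h] i].
  split; first by have := h (lshift n (0 : 'I_1)); rewrite (@col_mxEu _ 1 n 1) mxE eqxx mulr1n.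
  by move=> i; have := h (rshift 1 i); rewrite (@col_mxEd _ 1 n 1).
rewrite -[i](@splitK 1 n); case: (@fintype.split 1 n i) => j.
  by rewrite /= (@col_mxEu _ 1 n 1) (ord1 j) mxE eqxx mulr1n.
by rewrite /= (@col_mxEd _ 1 n 1); exact: h.
Qed.

(** Gives access to the iterated integral [lebesgue_cV] as a measure: restricted to a translate of
    the unit box and moved back, it is a law [b] chosen before the translation [v]. By induction [b]
    is a product of uniform laws on [0, 1]. *)
Lemma lebesgue_cV_unit_box n : exists b : probability 'cV[R]_n R,
  forall (v : 'cV[R]_n) (A : set 'cV[R]_n), measurable A ->
    lebesgue_cV [set x | A (x + v) /\ unit_box (x + v)] = b A.
Proof.
elim: n => [|n [b bE]].
  exists [the probability _ _ of \d_(0 : 'cV[R]_0)] => v A mA /=.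
  rewrite diracE (_ : [set x | _] = A) ?indicE//.
  apply/seteqP; split => x /=; rewrite (flatmx0 (x + v)) (flatmx0 x).
    by case.
  by move=> Ax; split => // -[].
pose f (p : measurableTypeR R * 'cV[R]_n) : 'cV[R]_n.+1 :=
  col_mx (p.1%:M : 'cV[R]_1) p.2.
have mf : measurable_fun setT f.
  apply: (@measurable_col_mx _ _ _ 1 n 1); last exact: measurable_snd.
  apply/measurable_mxP => i j; rewrite (ord1 i) (ord1 j).
  by under eq_fun do rewrite mxE eqxx mulr1n; exact: measurable_fst.
have [b' b'E] := exists_image_probability
  [the probability _ _ of (uniform_prob (@ltr01 R) \x b)%E] mf.
exists b' => v A mA; rewrite b'E.
pose g (t : R) : \bar R :=
  ((\1_(`[0, 1]%classic) t)%:E * b (xsection (f @^-1` A) t))%E.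
have mfA : measurable (f @^-1` A) by rewrite -[X in measurable X]setTI; exact: mf.
have mb : measurable_fun setT (fun t : measurableTypeR R => b (xsection (f @^-1` A) t)).
  exact: measurable_fun_xsection.
have mg : measurable_fun setT g.
  by apply: emeasurable_funM => //; apply/measurable_EFinP; exact: measurable_indic.
have g0 t : (0 <= g t)%E by rewrite mule_ge0// lee_fin.
pose v0 := v 0 0; pose v' : 'cV[R]_n := dsubmx (v : 'cV[R]_(1 + n)).
have vE : v = col_mx (v0%:M : 'cV[R]_1) v'.
  have <- : usubmx (v : 'cV[R]_(1 + n)) = v0%:M.
    apply/matrixP => i j; rewrite (ord1 i) (ord1 j) !mxE eqxx mulr1n /v0.
    by congr (v _ _); apply/val_inj.
  by rewrite [RHS](@vsubmxK _ 1 n 1).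
(* The slice at [t] is an instance of the induction hypothesis with translation [v']; the first
   coordinate is shifted by [v0]. *)
transitivity (\int[@lebesgue_measure R]_t g (t + v0)%R)%E.
  apply: eq_integral => t _; rewrite /g.
  have shift w : (col_mx (t%:M : 'cV[R]_1) w : 'cV[R]_n.+1) + v =
      col_mx ((t + v0)%:M : 'cV[R]_1) (w + v').
    by rewrite vE (@add_col_mx _ 1 n 1) -raddfD.
  have [t01|t01] := boolP (0 <= t + v0 <= 1).
    rewrite indicE mem_set ?mul1e/= ?in_itv//= -(bE v'); last first.
      exact: measurable_xsection.
    congr lebesgue_cV; apply/seteqP; split => w /=.
      by rewrite shift => -[Aw /unit_box_col_mx[_ ?]]; split => //; apply/mem_set.
    rewrite shift => -[/set_mem Aw ?]; split => //.
    exact/unit_box_col_mx.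
  rewrite indicE memNset ?mul0e/= ?in_itv//=; last exact/negP.
  (* The slice is empty; the induction hypothesis at [set0] evaluates [lebesgue_cV] on it. *)
  transitivity (b set0); last exact: measure0.
  rewrite -(bE v')//; congr lebesgue_cV.
  apply/seteqP; split => w /=; last by case.
  by rewrite shift => -[_ /unit_box_col_mx[t01']]; rewrite t01' in t01.
rewrite integral_lebesgue_addr// -[RHS]/((_ \x b)%E (f @^-1` A)) /product_measure1.
rewrite integral_uniform// subr0 invr1 mul1e [RHS]integral_mkcond.
apply: eq_integral => t _; rewrite /g patchE indicE.
by case: ifPn => _ /=; rewrite ?mul1e ?mul0e.
Qed.

End unit_box.

(** * Generating classes and rectangles of noise values *)

Section generated.
Context d (Y : measurableType d) (R : realType) (G : set (set Y)).
Hypotheses (mG : G `<=` measurable) (GI : setI_closed G) (GT : G setT).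
Hypothesis Gmeasurable : measurable_fun setT (id : g_sigma_algebraType G -> Y).

(** [Gmeasurable] expresses that [G] generates; as measurability of the identity it can be checked
    component by component. *)
Lemma measurable_sub_generated : measurable `<=` <<s G >>.
Proof. by move=> A mA; have := Gmeasurable measurableT mA; rewrite setTI. Qed.

Lemma generated_probability_unique (m1 m2 : probability Y R) :
  (forall A, G A -> m1 A = m2 A) -> forall A, measurable A -> m1 A = m2 A.
Proof.
move=> m12 A mA.
apply: (@g_sigma_algebra_measure_unique _ _ _ G mG (fun=> setT)) => //.
- by rewrite bigcup_const.
- by move=> n; rewrite /= probability_setT ltry.
- exact: measurable_sub_generated.
Qed.

(** The measurable sets whose measure depends measurably on [x] form a lambda-system, and it
    contains the pi-system [G]. *)
Lemma generated_kernel d' (X : measurableType d') (m : X -> probability Y R) :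
  (forall A, G A -> measurable_fun setT (fun x => m x A)) ->
  forall A, measurable A -> measurable_fun setT (fun x => m x A).
Proof.
move=> mm A mA.
pose Z := [set A | measurable A /\ measurable_fun setT (fun x => m x A)].
suff : <<s G >> `<=` Z by move=> /(_ A (measurable_sub_generated mA))[].
apply: (lambda_system_subset GI (D := setT)) => //; last first.
  by move=> B GB; split; [exact: mG|exact: mm].
apply/dynkin_lambda_system; split.
- split => //; rewrite (_ : (fun x => _) = cst 1%E) //.
  by apply/funext => x; rewrite probability_setT.
- move=> B [mB mmB]; split; first exact: measurableC.
  rewrite (_ : (fun x => _) = (fun x => 1 - m x B)%E).
    exact: emeasurable_funB.
  by apply/funext => x; rewrite probability_setC.
- move=> F tF mF; have mF' k : measurable (F k) by case: (mF k).
  split; first exact: bigcupT_measurable.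
  rewrite (_ : (fun x => _) = (fun x => \sum_(k <oo) m x (F k))%E).
    by apply: ge0_emeasurable_sum => k; case: (mF k).
  apply/funext => x; apply/esym/cvg_lim => //.
  by apply: measure_semi_sigma_additive => //; exact: bigcupT_measurable.
Qed.

End generated.

Section rectangles.
Context d1 d2 (S1 : measurableType d1) (S2 : measurableType d2) (n : nat).
Implicit Types (A : 'I_n -> set S1) (B : 'I_n -> set S2).

Definition rect A B : set (n.-tuple (S1 * S2)) :=
  [set t | forall i, A i (tnth t i).1 /\ B i (tnth t i).2].

Definition rects : set (set (n.-tuple (S1 * S2))) :=
  [set D | exists A B, [/\ forall i, measurable (A i),
     forall i, measurable (B i) & D = rect A B]].

Lemma measurable_tnth1 i : measurable_fun setT
  (fun t : n.-tuple (S1 * S2) => (tnth t i).1).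
Proof. exact: (measurableT_comp measurable_fst (measurable_tnth i)). Qed.

Lemma measurable_tnth2 i : measurable_fun setT
  (fun t : n.-tuple (S1 * S2) => (tnth t i).2).
Proof. exact: (measurableT_comp measurable_snd (measurable_tnth i)). Qed.

Lemma measurable_rect A B : (forall i, measurable (A i)) ->
  (forall i, measurable (B i)) -> measurable (rect A B).
Proof.
move=> mA mB; rewrite (_ : rect A B = \bigcap_(i in [set: 'I_n])
    ((fun t => (tnth t i).1) @^-1` A i `&` (fun t => (tnth t i).2) @^-1` B i)).
  apply: fin_bigcap_measurable => // i _; apply: measurableI.
    by rewrite -[X in measurable X]setTI; exact: measurable_tnth1.
  by rewrite -[X in measurable X]setTI; exact: measurable_tnth2.
by apply/seteqP; split => t /= h i; [move=> _|]; exact: h.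
Qed.

Lemma rects_measurable : rects `<=` measurable.
Proof. by move=> _ [A [B [mA mB ->]]]; exact: measurable_rect. Qed.

Lemma rectsI : setI_closed rects.
Proof.
move=> _ _ [A [B [mA mB ->]]] [A' [B' [mA' mB' ->]]].
exists (fun i => A i `&` A' i), (fun i => B i `&` B' i); split.
- by move=> i; exact: measurableI.
- by move=> i; exact: measurableI.
- apply/seteqP; split => t /=.
    by move=> [h h'] i; have [? ?] := h i; have [? ?] := h' i.
  by move=> h; split => i; have [[? ?] [? ?]] := h i.
Qed.

Lemma rectT : rect (fun=> setT) (fun=> setT) = setT.
Proof. exact/seteqP. Qed.

Lemma rectsT : rects setT.
Proof. by exists (fun=> setT), (fun=> setT); rewrite rectT. Qed.

Let coord i C : rect (fun j => if j == i then C else setT) (fun=> setT) =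
  (fun t => (tnth t i).1) @^-1` C.
Proof.
apply/seteqP; split => t /=; first by move=> /(_ i); rewrite eqxx => -[].
by move=> Ct j; split => //; case: eqVneq => // ->.
Qed.

Let coord2 i C : rect (fun=> setT) (fun j => if j == i then C else setT) =
  (fun t => (tnth t i).2) @^-1` C.
Proof.
apply/seteqP; split => t /=; first by move=> /(_ i); rewrite eqxx => -[].
by move=> Ct j; split => //; case: eqVneq => // ->.
Qed.

(** The map [f] is the identity for noises alone and the second projection for pairs of a state and
    noises. *)
Lemma rects_generate d (Y : measurableType d) (G : set (set Y))
    (f : Y -> n.-tuple (S1 * S2)) :
  (forall D, rects D -> G (f @^-1` D)) ->
  measurable_fun setT (f : g_sigma_algebraType G -> _).
Proof.
move=> fG; apply/measurable_fun_tnthP => i; apply/measurable_fun_pairP; split.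
  move=> _ C mC; rewrite setTI; apply: sub_sigma_algebra.
  rewrite -[X in G X]/(f @^-1` ((fun t => (tnth t i).1) @^-1` C)) -coord.
  apply: fG; exists (fun j => if j == i then C else setT), (fun=> setT).
  by split => // j; case: ifP.
move=> _ C mC; rewrite setTI; apply: sub_sigma_algebra.
rewrite -[X in G X]/(f @^-1` ((fun t => (tnth t i).2) @^-1` C)) -coord2.
apply: fG; exists (fun=> setT), (fun j => if j == i then C else setT).
by split => // j; case: ifP.
Qed.

End rectangles.

(** * Joint laws, and products with a common minorant *)

Section joint_law.
Context d d' (X : measurableType d) (N : measurableType d') (R : realType).
Variables (mu : probability X R) (L : R.-pker X ~> N).
Local Open Scope ereal_scope.

Let j (D : set (X * N)) := \int[mu]_x L x (xsection D x).

Let mL D : measurable D -> measurable_fun setT (fun x => L x (xsection D x)).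
Proof. by move=> mD; apply: measurable_fun_xsection_finite_kernel; rewrite inE. Qed.

Let j0 : j set0 = 0.
Proof. by rewrite [LHS]integral0_eq// => x/= _; rewrite xsection0. Qed.

Let j_ge0 D : 0 <= j D.
Proof. exact: integral_ge0. Qed.

Let j_sigma_additive : semi_sigma_additive j.
Proof.
move=> F mF tF mUF.
rewrite [X in _ --> X](_ : _ = \sum_(n <oo) j (F n)).
  by apply/cvg_closeP; split; [exact: is_cvg_nneseries|rewrite closeE].
rewrite -integral_nneseries//; last by move=> n; exact: mL.
apply: eq_integral => x _; apply/esym/cvg_lim => //=; rewrite xsection_bigcup.
apply: (measure_sigma_additive _ (trivIset_xsection tF)) => ?.
exact: measurable_xsection.
Qed.

Let j_measure : {measure set (X * N) -> \bar R} :=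
  HB.pack j (isMeasure.Build _ _ _ _ j0 j_ge0 j_sigma_additive).

Let j_setT : j_measure setT = 1.
Proof.
rewrite -[RHS](integral_cst_probability 1 (probability_setT mu)).
apply: eq_integral => x _; rewrite -[RHS](prob_kernel (s := L) x).
by congr (L x _); apply/seteqP; split => y // _; rewrite /xsection /= in_setT.
Qed.

Let j_probability : probability (X * N)%type R := HB.pack (Measure.sort j_measure)
  (Measure_isProbability.Build _ _ _ j_measure j_setT).

Lemma exists_joint_probability : exists J : probability (X * N)%type R,
  forall D, J D = \int[mu]_x L x (xsection D x).
Proof. by exists j_probability. Qed.

End joint_law.

Lemma measurable_tuple_box d (S : measurableType d) n (A : 'I_n -> set S) :
  (forall i, measurable (A i)) ->
  measurable [set t : n.-tuple S | forall i, A i (tnth t i)].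
Proof.
move=> mA; rewrite (_ : [set t | _] =
    \bigcap_(i in [set: 'I_n]) (fun t : n.-tuple S => tnth t i) @^-1` A i).
  apply: fin_bigcap_measurable => // i _.
  by rewrite -[X in measurable X]setTI; exact: measurable_tnth.
by apply/seteqP; split => t /= h i; [move=> _|]; exact: h.
Qed.

Section product_domination.
Context d (S : measurableType d) (R : realType).
Local Open Scope ereal_scope.

Lemma ge0_integral_domination (lam m : {measure set S -> \bar R}) (a : R)
    (f : S -> \bar R) : (0 <= a)%R ->
  (forall A, measurable A -> a%:E * lam A <= m A) ->
  (forall x, 0 <= f x) -> measurable_fun setT f ->
  a%:E * \int[lam]_x f x <= \int[m]_x f x.
Proof.
move=> a0 am f0 mf.
rewrite -[a]/((NngNum a0)%:num) -ge0_integral_mscale//.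
by apply: ge0_le_measure_integral => // A mA; exact: am.
Qed.

(** [Lam], a power of [lam], is fixed before the factors [m] and the constant [a], so one measure
    serves all such products. Each coordinate of the iterated integral contributes one factor
    [a]. *)
Lemma exists_tuple_product n (lam : probability S R) :
  exists Lam : probability (n.-tuple S) R,
  forall (m : 'I_n -> probability S R) (a : R), (0 <= a)%R ->
    (forall i A, measurable A -> a%:E * lam A <= m i A) ->
  exists M : probability (n.-tuple S) R,
    (forall A : 'I_n -> set S, (forall i, measurable (A i)) ->
       M [set t | forall i, A i (tnth t i)] = \prod_i m i (A i)) /\
    (forall D, measurable D -> (a ^+ n)%:E * Lam D <= M D).
Proof.
elim: n => [|n [Lam IH]].
  exists [the probability _ _ of \d_([tuple] : 0.-tuple S)] => m a a0 am.
  exists [the probability _ _ of \d_([tuple] : 0.-tuple S)]; split.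
    move=> A mA; rewrite big_ord0 /= diracE mem_set// => -[].
    by [].
  by move=> D mD; rewrite expr0 mul1e.
pose f (p : (S * n.-tuple S)%type) := [the n.+1.-tuple S of p.1 :: p.2].
have mf : measurable_fun setT f.
  by apply: measurable_cons; [exact: measurable_fst|exact: measurable_snd].
have [Lam1 Lam1E] := exists_image_probability
  [the probability _ _ of lam \x Lam] mf.
exists Lam1 => m a a0 am.
have [//|M [Mrect Mdom]] := IH (fun i => m (lift ord0 i)) a a0.
  by move=> i; exact: am.
have [M1 M1E] := exists_image_probability
  [the probability _ _ of (m ord0) \x M] mf.
exists M1; split.
  move=> A mA; rewrite M1E big_ord_recl /= -Mrect//.
  have mbox := measurable_tuple_box (fun i => mA (lift ord0 i)).
  rewrite -(product_measure1E (m ord0) M (mA ord0) mbox).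
  congr (_ _); apply/seteqP; split => -[x t] /=.
    move=> h; split; first exact: (h ord0).
    by move=> i; have := h (lift ord0 i); rewrite tnthS.
  move=> [x0 h] i; case: (unliftP ord0 i) => [j ->|->//].
  by rewrite tnthS; exact: h.
move=> D mD; rewrite Lam1E M1E.
have mfD : measurable (f @^-1` D) by rewrite -[X in measurable X]setTI; exact: mf.
rewrite /= /product_measure1 exprS EFinM -muleA.
rewrite -ge0_integralZl//; [|exact: measurable_fun_xsection|by rewrite lee_fin exprn_ge0].
(* The sections are compared first, under [lam]; then [lam] is compared with [m ord0]. *)
apply: (@le_trans _ _ (a%:E * \int[lam]_x (M \o xsection (f @^-1` D)) x)).
  rewrite lee_wpmul2l ?lee_fin//; apply: ge0_le_integral => //.
  - by move=> x _; rewrite mule_ge0// lee_fin exprn_ge0.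
  - by apply: emeasurable_funM => //; exact: measurable_fun_xsection.
  - exact: measurable_fun_xsection.
  - by move=> x _; apply: Mdom; exact: measurable_xsection.
by apply: ge0_integral_domination => //; [exact: am|exact: measurable_fun_xsection].
Qed.

End product_domination.

Lemma exists_probability d (T : measurableType d) (R : realType)
    (m : {measure set T -> \bar R}) : m setT = 1%E ->
  exists P : probability T R, forall A, P A = m A.
Proof.
move=> m1; pose v A := m A.
have v0 : v set0 = 0%E by exact: measure0.
have v_ge0 A : (0 <= v A)%E by exact: measure_ge0.
have v_add : semi_sigma_additive v by exact: measure_semi_sigma_additive.
pose vm : {measure set T -> \bar R} :=
  HB.pack v (isMeasure.Build _ _ _ _ v0 v_ge0 v_add).
pose vp : probability T R :=
  HB.pack (Measure.sort vm) (Measure_isProbability.Build _ _ _ vm m1).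
by exists vp.
Qed.

Lemma exists_pker d d' (X : measurableType d) (Y : measurableType d')
    (R : realType) (m : X -> probability Y R) :
  (forall A, measurable A -> measurable_fun setT (fun x => m x A)) ->
  exists k : R.-pker X ~> Y, forall x A, k x A = m x A.
Proof.
move=> mm; pose k x : {measure set Y -> \bar R} := m x.
have k1 x : k x setT = 1%E by exact: probability_setT.
pose k0 : R.-ker X ~> Y := HB.pack k (isKernel.Build _ _ _ _ _ k mm).
pose kp : R.-pker X ~> Y :=
  HB.pack (Kernel.sort k0) (Kernel_isProbability.Build _ _ _ _ _ k0 k1).
by exists kp.
Qed.

Lemma emeasurable_fun_prod d (T : measurableType d) (R : realType) (I : Type)
    (s : seq I) (f : I -> T -> \bar R) :
  (forall i, measurable_fun setT (f i)) ->
  measurable_fun setT (fun x => \prod_(i <- s) f i x)%E.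
Proof.
move=> mf; elim: s => [|i s IHs].
  by under eq_fun do rewrite big_nil; exact: measurable_cst.
by under eq_fun do rewrite big_cons; exact: emeasurable_funM.
Qed.

(** * One EnKF step as a map of the state and the noises *)

Section enkf_kernel.
Context (R : realType) (d q K : nat).
Local Notation X := ('cV[R]_d * 'M[R]_(d, K))%type.
Local Notation N := (K.+1.-tuple ('cV[R]_d * 'cV[R]_q)).
Variables (H : 'M[R]_(q, d)) (Psi : 'cV[R]_d -> 'cV[R]_d).
Hypothesis mPsi : measurable_fun setT Psi.
Variables (Q : R.-pker 'cV[R]_d ~> 'cV[R]_d) (nu : probability 'cV[R]_q R).

(* Index 0 stands for the signal, index k + 1 for the k-th ensemble member. *)
Definition pos (x : X) (i : 'I_K.+1) : 'cV[R]_d :=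
  if unlift ord0 i is Some k then col k x.2 else x.1.

Lemma measurable_pos i : measurable_fun setT (pos ^~ i).
Proof.
rewrite /pos; case: unliftP => [k _|_] /=; last exact: measurable_fst.
by apply: measurable_col; exact: measurable_snd.
Qed.

(** Turns system noises into forecasts and holds all the dependence on the state; [output] is then a
    fixed map, which carries a common minorant to the state space. *)
Definition shift (x : X) (t : N) : N :=
  [tuple (Psi (pos x i) + (tnth t i).1, (tnth t i).2) | i < K.+1].

Definition output (t : N) : X :=
  ((tnth t ord0).1,
   analysis H (\matrix_(i, k) (tnth t (lift ord0 k)).1 i 0)
     (fun k => H *m (tnth t ord0).1 + (tnth t ord0).2 + (tnth t (lift ord0 k)).2)).

Lemma measurable_output : measurable_fun setT output.
Proof.
apply/measurable_fun_pairP; split; first exact: measurable_tnth1.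
apply: measurable_analysis => [|k].
  apply/measurable_mxP => i k; under eq_fun do rewrite mxE.
  apply: (@measurable_mxE _ _ _ _ _ (fun t : N => (tnth t (lift ord0 k)).1)).
  exact: measurable_tnth1.
apply: measurable_addmx; last exact: measurable_tnth2.
apply: measurable_addmx; last exact: measurable_tnth2.
by apply: measurable_mulmx; [exact: measurable_cst|exact: measurable_tnth1].
Qed.

Lemma measurable_shift : measurable_fun setT (fun p : X * N => shift p.1 p.2).
Proof.
apply/measurable_fun_tnthP => i; rewrite [X in measurable_fun _ X](_ : _ =
    (fun p : X * N => (Psi (pos p.1 i) + (tnth p.2 i).1, (tnth p.2 i).2))); last first.
  by apply/funext => p; rewrite /= tnth_mktuple.
apply/measurable_fun_pairP; split.
  apply: measurable_addmx.
    apply: (measurableT_comp mPsi).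
    exact: (measurableT_comp (measurable_pos i) measurable_fst).
  exact: (measurableT_comp (@measurable_tnth1 _ _ _ _ _ i) measurable_snd).
exact: (measurableT_comp (@measurable_tnth2 _ _ _ _ _ i) measurable_snd).
Qed.

Lemma measurable_shift_at x : measurable_fun setT (shift x).
Proof.
apply: (@measurableT_comp _ _ _ _ _ _ (fun p : X * N => shift p.1 p.2) _ (pair x)).
  exact: measurable_shift.
by apply/measurable_fun_pairP; split; [exact: measurable_cst|exact: measurable_id].
Qed.

(** A product law is chosen for each state; its measurability in the state is only checked on
    rectangles, where it is a finite product of measurable functions. *)
Lemma exists_noise_kernel : exists L : R.-pker X ~> N,
  forall x A B, (forall i, measurable (A i)) -> (forall i, measurable (B i)) ->
  L x (rect A B) = (\prod_i (Q (pos x i) (A i) * nu (B i)))%E.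
Proof.
have exQ u := exists_probability (prob_kernel (s := Q) u).
have /choice[M ML] x : exists M : probability N R,
    forall A B, (forall i, measurable (A i)) -> (forall i, measurable (B i)) ->
    M (rect A B) = (\prod_i (Q (pos x i) (A i) * nu (B i)))%E.
  have /choice[Q' Q'E] u := exQ u.
  have [Lam dom] := exists_tuple_product K.+1
    [the probability _ _ of (Q' x.1 \x nu)%E].
  (* With [a = 0] the domination is void and only the product law is retained. *)
  have [//||M [Mrect _]] :=
    dom (fun i => [the probability _ _ of (Q' (pos x i) \x nu)%E]) 0.
    by move=> i A mA; rewrite mul0e.
  exists M => A B mA mB.
  have := Mrect (fun i => A i `*` B i) (fun i => measurableX (mA i) (mB i)).
  rewrite -/(rect A B) => ->.
  by apply: eq_bigr => i _; rewrite -Q'E /= product_measure1E.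
have mM A : measurable A -> measurable_fun setT (fun x => M x A).
  apply: (generated_kernel (@rects_measurable _ _ _ _ K.+1)).
  - exact: rectsI.
  - exact: rects_generate.
  move=> _ [A1 [B1 [mA mB ->]]].
  under eq_fun do rewrite ML//.
  apply: emeasurable_fun_prod => i; apply: emeasurable_funM => //.
  exact: (measurableT_comp (measurable_kernel Q _ (mA i)) (measurable_pos i)).
have [L LE] := exists_pker mM.
by exists L => x A B mA mB; rewrite LE ML.
Qed.

End enkf_kernel.

(** * The laws of the EnKF process form a Markov chain *)

Section enkf_chain.
Context (R : realType) (d q K : nat).
Local Notation X := ('cV[R]_d * 'M[R]_(d, K))%type.
Local Notation N := (K.+1.-tuple ('cV[R]_d * 'cV[R]_q)).
Variables (H : 'M[R]_(q, d)) (Psi : 'cV[R]_d -> 'cV[R]_d).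
Hypothesis mPsi : measurable_fun setT Psi.
Variables (Q : R.-pker 'cV[R]_d ~> 'cV[R]_d) (nu : probability 'cV[R]_q R).
Variable L : R.-pker X ~> N.
Hypothesis L_rect : forall x A B,
  (forall i, measurable (A i)) -> (forall i, measurable (B i)) ->
  L x (rect A B) = (\prod_i (Q (pos x i) (A i) * nu (B i)))%E.
Context (dO : measure_display) (Omega : measurableType dO).
Variables (p : enkf_process R d q K Omega) (dynp : enkf_dynamics Psi H p).

Definition noise n (w : Omega) : N :=
  [tuple (if unlift ord0 i is Some k then ens_sys_noise p n k w
          else sys_noise p n w,
          if unlift ord0 i is Some k then ens_obs_noise p n k w
          else obs_noise p n w) | i < K.+1].

Lemma measurable_noise n : measurable_fun setT (noise n).
Proof.
apply/measurable_fun_tnthP => i; rewrite [X in measurable_fun _ X](_ : _ =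
    (fun w => (if unlift ord0 i is Some k then ens_sys_noise p n k w
          else sys_noise p n w,
          if unlift ord0 i is Some k then ens_obs_noise p n k w
          else obs_noise p n w))); last first.
  by apply/funext => w; rewrite /= tnth_mktuple.
apply/measurable_fun_pairP; split; rewrite /comp /=; case: unliftP => [k _|_].
- exact: (measurable_ens_sys_noise dynp).
- exact: (measurable_sys_noise dynp).
- exact: (measurable_ens_obs_noise dynp).
- exact: (measurable_obs_noise dynp).
Qed.

Lemma measurable_state n : measurable_fun setT (state p n).
Proof.
apply/measurable_fun_pairP; split.
  exact: (measurable_signal dynp).
exact: (measurable_ensemble dynp).
Qed.

Lemma state_step n w :
  state p n.+1 w = output H (shift Psi (state p n w) (noise n.+1 w)).
Proof.
have pos0 x : pos x ord0 = x.1 :> 'cV[R]_d by rewrite /pos unlift_none.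
have posk (x : X) k : pos x (lift ord0 k) = col k x.2 by rewrite /pos liftK.
rewrite /state /output !tnth_mktuple /= unlift_none pos0 /=.
rewrite (signal_step dynp); congr pair.
rewrite (ensemble_step dynp); congr analysis.
  by apply/matrixP => i k; rewrite !mxE !tnth_mktuple /= liftK posk ?mxE.
apply/funext => k; rewrite (obs_step dynp) (signal_step dynp).
by rewrite !tnth_mktuple /= liftK.
Qed.

Definition enkf_step (z : X * N) : X := output H (shift Psi z.1 z.2).

Lemma measurable_enkf_step : measurable_fun setT enkf_step.
Proof. exact: (measurableT_comp (measurable_output H) (measurable_shift mPsi)). Qed.

Section law.
Variables (P : probability Omega R) (mu : probability X R).
Hypothesis lawp : enkf_law Q nu P mu p.

Let prod_rect x A B : (forall i, measurable (A i)) -> (forall i, measurable (B i)) ->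
  (Q x.1 (A ord0) * (\prod_(k < K) Q (col k x.2) (A (lift ord0 k)))
   * nu (B ord0) * (\prod_(k < K) nu (B (lift ord0 k))) = L x (rect A B))%E.
Proof.
move=> mA mB; rewrite L_rect// big_ord_recl big_split /=.
rewrite /pos unlift_none; under [in RHS]eq_bigr do rewrite liftK.
by rewrite -!muleA; congr (_ * _)%E; rewrite muleCA.
Qed.

Lemma past_state n (C : set X) : measurable C -> past (state p) n (state p n @^-1` C).
Proof.
move=> mC; apply: sub_sigma_algebra; exists n => //=.
by exists C => //; rewrite setTI.
Qed.

(** The event on the state at time [n] belongs to the past, so the conditional law of the noises is
    integrated over it. *)
Lemma law_state_noise_rect n (C : set X) A B : measurable C ->
  (forall i, measurable (A i)) -> (forall i, measurable (B i)) ->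
  (P (state p n @^-1` C `&` noise n.+1 @^-1` rect A B) =
   \int[P]_(w in state p n @^-1` C) L (state p n w) (rect A B))%E.
Proof.
move=> mC mA mB.
have [_ _ ce] := noise_law lawp n (mA ord0) (fun k => mA (lift ord0 k))
  (mB ord0) (fun k => mB (lift ord0 k)).
have mCX : measurable (state p n @^-1` C).
  by rewrite -[X in measurable X]setTI; exact: measurable_state.
have mN : measurable (noise n.+1 @^-1` rect A B).
  rewrite -[X in measurable X]setTI; apply: measurable_noise => //.
  exact: measurable_rect.
rewrite setIC -integral_indic//.
rewrite [RHS](eq_integral (fun w =>
    Q (signal p n w) (A ord0)
    * (\prod_(k < K) Q (col k (ensemble p n w)) (A (lift ord0 k)))
    * nu (B ord0) * (\prod_(k < K) nu (B (lift ord0 k))))%E); last first.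
  by move=> w _; rewrite -(prod_rect (state p n w) mA mB).
rewrite ce; last exact: past_state.
apply: eq_integral => w _; congr (\1_ _ w)%:E; symmetry.
apply/seteqP; split => w' /=.
  move=> [hA hA' hB hB'] i; rewrite tnth_mktuple /=.
  by case: (unliftP ord0 i) => [k ->|->].
move=> h; split => [|k||k].
- by have [] := h ord0; rewrite tnth_mktuple /= unlift_none.
- by have [] := h (lift ord0 k); rewrite tnth_mktuple /= liftK.
- by have [_] := h ord0; rewrite tnth_mktuple /= unlift_none.
- by have [_] := h (lift ord0 k); rewrite tnth_mktuple /= liftK.
Qed.

(** Products of a state event and a rectangle generate, so the joint law of the state and the next
    noises is the semidirect product of [S] and [L]; the next state is its image by [enkf_step]. *)
Lemma law_stateS n (S S' : probability X R) :
  (forall A, measurable A -> S A = P (state p n @^-1` A)) ->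
  (forall A, measurable A -> S' A = P (state p n.+1 @^-1` A)) ->
  forall A, measurable A ->
  (S' A = \int[S]_x L x (xsection (enkf_step @^-1` A) x))%E.
Proof.
move=> SE S'E A mA.
have [J JE] := exists_joint_probability S L.
pose f w := (state p n w, noise n.+1 w).
have mf : measurable_fun setT f.
  by apply/measurable_fun_pairP; split; [exact: measurable_state|exact: measurable_noise].
have [J' J'E] := exists_image_probability P mf.
pose G : set (set (X * N)) := [set D | exists C D', [/\ measurable C,
  rects D' & D = C `*` D']].
have mG : G `<=` measurable.
  by move=> _ [C [D [mC /rects_measurable mD ->]]]; exact: measurableX.
have GI : setI_closed G.
  move=> _ _ [C [D [mC rD ->]]] [C' [D' [mC' rD' ->]]].
  exists (C `&` C'), (D `&` D'); split; [exact: measurableI|exact: rectsI|].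
  by rewrite setXI.
have GT : G setT by exists setT, setT; split; [|exact: rectsT|rewrite setXTT].
have Ggen : measurable_fun setT (id : g_sigma_algebraType G -> (X * N)%type).
  apply/measurable_fun_pairP; split.
    move=> _ C mC; rewrite setTI; apply: sub_sigma_algebra.
    by exists C, setT; split => //; [exact: rectsT|rewrite setXT].
  apply: rects_generate => D rD; exists setT, D; split => //.
  by rewrite setTX.
have JJ' : forall D, measurable D -> J' D = J D.
  apply: (generated_probability_unique mG GI GT Ggen).
  move=> _ [C [D [mC [A1 [B1 [mA1 mB1 ->]]] ->]]].
  rewrite J'E JE -[LHS]/(P (state p n @^-1` C `&` noise n.+1 @^-1` rect A1 B1)).
  rewrite law_state_noise_rect//.
  rewrite (_ : (\int[S]_x _)%E = (\int[S]_(x in C) L x (rect A1 B1))%E); last first.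
    rewrite [RHS]integral_mkcond; apply: eq_integral => x _; rewrite patchE.
    case: ifPn => xC; first by rewrite in_xsectionX.
    by rewrite notin_xsectionX ?measure0.
  rewrite (ge0_integral_image (measurable_state n) SE)//.
  apply: measurable_funTS; apply: measurable_kernel; exact: measurable_rect.
have mstep : measurable (enkf_step @^-1` A).
  by rewrite -[X in measurable X]setTI; exact: measurable_enkf_step.
rewrite S'E// -JE -JJ'// J'E; congr (P _).
by apply/seteqP; split => w /=; rewrite state_step.
Qed.

End law.
End enkf_chain.

(** * A minorizing measure common to a set of states *)

Section minorization.
Context (R : realType) (d q K : nat).
Local Notation X := ('cV[R]_d * 'M[R]_(d, K))%type.
Local Notation N := (K.+1.-tuple ('cV[R]_d * 'cV[R]_q)).
Variables (H : 'M[R]_(q, d)) (Psi : 'cV[R]_d -> 'cV[R]_d).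
Hypothesis mPsi : measurable_fun setT Psi.
Variables (Q : R.-pker 'cV[R]_d ~> 'cV[R]_d) (nu : probability 'cV[R]_q R).
Variable L : R.-pker X ~> N.
Hypothesis L_rect : forall x A B,
  (forall i, measurable (A i)) -> (forall i, measurable (B i)) ->
  L x (rect A B) = (\prod_i (Q (pos x i) (A i) * nu (B i)))%E.

Let measurable_preimage_add (u : 'cV[R]_d) (A : set 'cV[R]_d) : measurable A ->
  measurable ((fun z => u + z) @^-1` A).
Proof.
move=> mA; rewrite -[X in measurable X]setTI.
have : measurable_fun setT (fun z : 'cV[R]_d => u + z).
  by apply: measurable_addmx; [exact: measurable_cst|exact: measurable_id].
by apply.
Qed.

(** Each of the [K.+1] forecasts, paired with its observation noise, dominates [alpha] times the
    product of [b] and [nu]; this yields the mass [alpha ^+ K.+1]. *)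
Lemma noise_kernel_minorization (b : probability 'cV[R]_d R) (C : set X) (alpha : R) :
  0 < alpha ->
  (forall x i (A : set 'cV[R]_d), C x -> measurable A ->
    (alpha%:E * b A <= Q (pos x i) ((fun z => Psi (pos x i) + z)%R @^-1` A))%E) ->
  exists2 eta : {measure set X -> \bar R}, (0 < eta setT)%E &
    forall x, C x -> forall A, measurable A ->
      (eta A <= L x ((output H \o shift Psi x) @^-1` A))%E.
Proof.
move=> alpha0 dom.
have [Lam LamP] := exists_tuple_product K.+1 [the probability _ _ of (b \x nu)%E].
have [Lam1 Lam1E] := exists_image_probability Lam (measurable_output H).
have a0 : 0 <= alpha ^+ K.+1 by rewrite exprn_ge0// ltW.
exists (mscale (NngNum a0) Lam1).
  apply: (@lt_le_trans _ _ ((alpha ^+ K.+1)%:E * 1)%E).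
    by rewrite mule1 lte_fin exprn_gt0.
  by rewrite -(probability_setT Lam1).
move=> x Cx A mA.
have exS i : exists S : probability 'cV[R]_d R,
    forall B : set 'cV[R]_d, S B = Q (pos x i) ((fun z => Psi (pos x i) + z)%R @^-1` B).
  have [Q' Q'E] := exists_probability (prob_kernel (s := Q) (pos x i)).
  have [|S SE] := @exists_image_probability _ _ _ _ _ Q'
    (fun z => Psi (pos x i) + z)%R.
    by apply: measurable_addmx; [exact: measurable_cst|exact: measurable_id].
  by exists S => B; rewrite SE Q'E.
have /choice[S SE] := exS.
have [||M [Mrect Mdom]] := LamP (fun i => [the probability _ _ of (S i \x nu)%E]) alpha.
- exact: ltW.
- move=> i D mD /=; rewrite /product_measure1.
  apply: ge0_integral_domination => //; first exact: ltW.
    by move=> B mB; have := dom x i B Cx mB; rewrite -SE.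
  exact: measurable_fun_xsection.
have [L1 L1E] := exists_probability (prob_kernel (s := L) x).
have [L2 L2E] := exists_image_probability L1 (measurable_shift_at mPsi x).
(* The preimage of a rectangle under the shift is again a rectangle, where [L_rect] is explicit: the
   shifted noises have the product law [M]. *)
have L2M : forall D, measurable D -> L2 D = M D.
  apply: (generated_probability_unique (@rects_measurable _ _ _ _ K.+1)).
  - exact: rectsI.
  - exact: rectsT.
  - exact: rects_generate.
  move=> _ [A1 [B1 [mA1 mB1 ->]]]; rewrite L2E L1E.
  rewrite (_ : _ @^-1` _ =
    rect (fun i => (fun z => Psi (pos x i) + z)%R @^-1` A1 i) B1); last first.
    apply/seteqP; split => t /= h i; have := h i.
      by rewrite tnth_mktuple.
    by rewrite tnth_mktuple.
  rewrite L_rect//; last by move=> i; exact: measurable_preimage_add.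
  have := Mrect (fun i => A1 i `*` B1 i) (fun i => measurableX (mA1 i) (mB1 i)).
  rewrite -/(rect A1 B1) => ->.
  by apply: eq_bigr => i _; rewrite -SE /= product_measure1E.
have mO : measurable (output H @^-1` A).
  by rewrite -[X in measurable X]setTI; exact: measurable_output.
rewrite (_ : L x _ = M (output H @^-1` A)).
  by have := Mdom _ mO; rewrite -Lam1E.
by rewrite -L2M// L2E L1E.
Qed.

End minorization.

(** * Euclidean bounds on positions and translated boxes *)

Section euclidean_bounds.
Context (R : realType).

Lemma enorm_ge0 n (u : 'cV[R]_n) : 0 <= enorm u.
Proof. exact: sqrtr_ge0. Qed.

Lemma sqr_enorm n (u : 'cV[R]_n) : enorm u ^+ 2 = \sum_i u i 0 ^+ 2.
Proof. by rewrite sqr_sqrtr// sumr_ge0// => i _; exact: sqr_ge0. Qed.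

(** From [t <= t ^+ 2 + 1], a crude bound that avoids square roots. *)
Lemma enorm_le n (u : 'cV[R]_n) (M : R) : 0 <= M -> enorm u ^+ 2 <= M ->
  enorm u <= M + 1.
Proof. by move=> M0 uM; have := enorm_ge0 u; nra. Qed.

(** In each coordinate [2 (z + v)^2 + 2 v^2 - z^2] is the square of [z + 2 v], and [(z + v)^2 <= 1]
    on the box. *)
Lemma enorm_unit_box_sub n (v z : 'cV[R]_n) : unit_box (z + v) ->
  enorm z ^+ 2 <= n%:R * 2 + 2 * enorm v ^+ 2.
Proof.
move=> zv; rewrite !sqr_enorm mulr_sumr.
rewrite (_ : n%:R * 2 = \sum_(i < n) (2 : R)); last first.
  by rewrite sumr_const card_ord mulr_natl.
rewrite -big_split; apply: ler_sum => i _ /=.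
have := zv i; rewrite mxE => /andP[s0 s1].
have := exprn_ile1 2 s0 s1; have := sqr_ge0 (z i 0 + 2 * v i 0); lra.
Qed.

Lemma measurable_unit_box n : measurable (@unit_box R n).
Proof.
rewrite (_ : @unit_box R n = \bigcap_(i in [set: 'I_n])
    (fun x : 'cV[R]_n => x i 0) @^-1` `[0, 1]).
  apply: fin_bigcap_measurable => // i _.
  by rewrite -[X in measurable X]setTI; apply: measurable_mx_entry.
apply/seteqP; split => x /= h i; first by move=> _; rewrite /= in_itv; exact: h.
by have := h i Logic.I; rewrite /= in_itv.
Qed.

Lemma compact_pos_bounded d K (C : set ('cV[R]_d * 'M[R]_(d, K))) : compact C ->
  exists2 M : R, 0 < M & forall x i, C x -> enorm (pos x i) <= M.
Proof.
move=> /compact_bounded[B [_ Bb]].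
pose b := `|B| + 1.
have hb x : C x -> `|x| <= b.
  by apply: Bb; rewrite /b (le_lt_trans (ler_norm _))// ltrDl.
have b0 : 0 < b by rewrite /b ltr_pwDr.
exists (d%:R * b ^+ 2 + 1).
  by rewrite ltr_pwDr// mulr_ge0// sqr_ge0.
move=> x i Cx; apply: enorm_le; first by rewrite mulr_ge0// sqr_ge0.
rewrite sqr_enorm (_ : d%:R * _ = \sum_(j < d) b ^+ 2); last first.
  by rewrite sumr_const card_ord mulr_natl.
have entry_le m n (A : 'M[R]_(m, n)) j k : `|A| <= b -> `|A j k| <= b.
  apply: le_trans; rewrite [leRHS]/Num.norm /= mx_normrE; apply/bigmax_geP.
  by right => /=; exists (j, k).
have := hb _ Cx; rewrite prod_normE ge_max => /andP[x1 x2].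
apply: ler_sum => j _; rewrite -real_normK ?num_real// lerXn2r ?nnegrE//.
  exact: ltW.
rewrite /pos; case: unliftP => [k _|_] /=; last exact: entry_le.
by rewrite mxE; exact: entry_le.
Qed.

End euclidean_bounds.

(** * Harris' hypotheses for the EnKF chain *)

Theorem theorem5p5 (R : realType) (d q K : nat)
    (q_gt0 : (0 < q)%N) (q_le_d : (q <= d)%N) (K_ge2 : (2 <= K)%N)
    (H : 'M[R]_(q, d)) (rankH : \rank H = q)
    (Psi : 'cV[R]_d -> 'cV[R]_d) (mPsi : measurable_fun setT Psi)
    (* Q u is the law of the system noise given that the signal was at u *)
    (Q : R.-pker 'cV[R]_d ~> 'cV[R]_d) (Rh : 'cV[R]_d -> 'M[R]_d)
    (momentsQ : forall u, has_mean_cov (Q u) 0 (Rh u))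
    (nu : probability 'cV[R]_q R) (momentsnu : has_mean_cov nu 0 1%:M)
    (dO : measure_display) (Omega : measurableType dO)
    (p : enkf_process R d q K Omega) (dynp : enkf_dynamics Psi H p)
    (Pr : probability ('cV[R]_d * 'M[R]_(d, K))%type R -> probability Omega R)
    (lawp : forall mu, enkf_law Q nu (Pr mu) mu p)
    (kinetic_energy : exists betah Kh : R, [/\ 0 < betah < 1, 0 < Kh &
       forall u, enorm (Psi u) ^+ 2 + \tr (Rh u)
                 <= (1 - betah) * enorm u ^+ 2 + Kh])
    (nondegenerate_noise : forall M1 M2 : R, 0 < M1 -> 0 < M2 ->
       exists2 alpha : R, 0 < alpha & forall u, enorm u <= M1 ->
         forall A, measurable A ->
           (alpha%:E * lebesgue_cV (A `&` eball M2) <= Q u A)%E)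
    (E : 'cV[R]_d * 'M[R]_(d, K) -> R) (E_ge0 : forall x, 0 <= E x)
    (E_compact : forall a : R, compact [set x | E x <= a])
    (beta c : R) (beta01 : 0 < beta < 1) (c_gt0 : 0 < c)
    (lyapunov : forall mu n, exists2 Y : Omega -> \bar R,
       is_cond_exp (Pr mu) (past (state p) n)
         (fun w => (E (state p n.+1 w))%:E) Y &
       {ae Pr mu, forall w,
         (Y w <= ((1 - beta) * E (state p n w) + c)%:E)%E}) :
  geometrically_ergodic Pr (state p) E.
Proof.
pose gamma := 1 - beta.
have gamma01 : 0 < gamma < 1 by rewrite /gamma; move: beta01 => /andP[? ?]; lra.
have mE : measurable_fun setT E by exact: measurable_compact_sublevel.
have [L L_rect] := exists_noise_kernel K Q nu.
have mstep := measurable_enkf_step H mPsi.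
(* The law of the next state from [x] is computed through [L], where its measurability in [x] is
   visible. *)
have /choice[out outE] x : exists S : probability ('cV[R]_d * 'M[R]_(d, K))%type R,
    forall A, S A = L x ((output H \o shift Psi x) @^-1` A).
  have [L1 L1E] := exists_probability (prob_kernel (s := L) x).
  have mo : measurable_fun setT (output H \o shift Psi x).
    exact: (measurableT_comp (measurable_output H) (measurable_shift_at mPsi x)).
  have [S SE] := exists_image_probability L1 mo.
  by exists S => A; rewrite SE L1E.
have xsectionE x A : xsection (enkf_step H Psi @^-1` A) x =
    (output H \o shift Psi x) @^-1` A.
  by apply/seteqP; split => t; rewrite /xsection /= inE.
have mout A : measurable A -> measurable_fun setT (fun x => out x A).
  move=> mA; under eq_fun do rewrite outE -xsectionE.
  apply: measurable_fun_xsection_finite_kernel; rewrite inE.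
  by rewrite -[X in measurable X]setTI; exact: mstep.
have [P PE] := exists_pker mout.
have /choice[law lawE] (mu : probability _ R) :
    exists m : nat -> probability ('cV[R]_d * 'M[R]_(d, K))%type R,
    forall n A, m n A = Pr mu (state p n @^-1` A).
  have /choice[m mE'] n :=
    exists_image_probability (Pr mu) (measurable_state dynp n).
  by exists m.
have law0 mu A : measurable A -> law mu 0%N A = mu A.
  by move=> mA; rewrite lawE (initial_law (lawp mu)).
have lawS mu : markov_chain P (law mu).
  move=> n A mA.
  rewrite (law_stateS mPsi L_rect dynp (lawp mu) (n := n) (S := law mu n))//.
  by apply: eq_integral => x _; rewrite PE outE xsectionE.
have transE x A : measurable A -> transition Pr (state p) x A = P x A.
  move=> mA; rewrite /transition -lawE lawS//.
  rewrite (eq_measure_integral [the measure _ _ of \d_x]); last first.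
    by move=> B mB _; exact: law0.
  rewrite integral_dirac//; last exact: measurable_kernel.
  by rewrite diracT mul1e.
(* [lyapunov] holds almost surely. Started at the Dirac mass at [x], with [n = 0], and integrated
   over the whole space, it becomes an inequality at the point [x]. *)
have drift x : (\int[P x]_y (E y)%:E <= (gamma * E x + c)%:E)%E.
  pose mu : probability ('cV[R]_d * 'M[R]_(d, K))%type R :=
    [the probability _ R of \d_x].
  have [Y [Y0 Ypast Yint] Yle] := lyapunov mu 0%N.
  have mY : measurable_fun setT Y.
    move=> _ B mB; rewrite setTI; move: (Ypast _ mB).
    move: (Y @^-1` B); apply: smallest_sub; first exact: sigma_algebra_measurable.
    move=> _ [m _ [C mC <-]].
    by apply: (measurable_state dynp m).
  have pastT : past (state p) 0 setT.
    apply: sub_sigma_algebra; exists 0%N => //=; exists setT => //.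
    by rewrite preimage_setT setTI.
  have mg : measurable_fun setT (fun y => (gamma * E y + c)%:E).
    apply/measurable_EFinP; apply: measurable_funD => //.
    exact: measurable_funM.
  have g0 y : (0 <= (gamma * E y + c)%:E)%E.
    rewrite lee_fin; move: gamma01 => /andP[? ?].
    by rewrite addr_ge0 ?mulr_ge0// ltW.
  rewrite (ge0_integral_image (measurable_state dynp 1) (P := Pr mu)); last 4 first.
  - move=> A mA; rewrite -transE//.
  - exact: measurableT.
  - exact/measurable_EFinP.
  - by move=> y; rewrite lee_fin.
  rewrite preimage_setT -(Yint _ pastT).
  apply: (@le_trans _ _ (\int[Pr mu]_w (gamma * E (state p 0 w) + c)%:E)%E).
    apply: ae_ge0_le_integral => //.
    - exact: (measurableT_comp mg (measurable_state dynp 0)).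
    - by apply: filterS Yle => w.
  have -> : (\int[Pr mu]_w (gamma * E (state p 0 w) + c)%:E =
      \int[mu]_y (gamma * E y + c)%:E)%E.
    rewrite (ge0_integral_image (measurable_state dynp 0) (P := Pr mu) (nu := mu))//.
    by move=> A mA; exact/esym/(initial_law (lawp mu)).
  by rewrite integral_dirac// diracT mul1e.
have minor a : exists2 eta : {measure set ('cV[R]_d * 'M[R]_(d, K))%type -> \bar R},
    (0 < eta setT)%E &
    forall x, E x <= a -> forall A, measurable A -> (eta A <= P x A)%E.
  have [M1 M10 CM1] := compact_pos_bounded (E_compact a).
  have [betah [Kh [/andP[bh0 bh1] Kh0 kin]]] := kinetic_energy.
  have trR u : 0 <= \tr (Rh u).
    rewrite sumr_ge0// => i _.
    have [_ _ cov] := momentsQ u.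
    rewrite -lee_fin -cov; apply: integral_ge0 => x _.
    by rewrite lee_fin -expr2 sqr_ge0.
  (* Bound on the squared norm over the unit box translated by [- Psi u], plus 1 to pass to the norm
     by [enorm_le]. *)
  pose M2 := d%:R * 2 + 2 * (M1 ^+ 2 + Kh) + 1.
  have M20 : 0 < M2.
    rewrite /M2 ltr_wpDl// addr_ge0// ?mulr_ge0// addr_ge0// ?sqr_ge0//.
    exact: ltW.
  have [alpha alpha0 noise_le] := nondegenerate_noise M1 M2 M10 M20.
  have [b bE] := lebesgue_cV_unit_box R d.
  have [|eta eta0 eta_le] := @noise_kernel_minorization _ _ _ _ H Psi mPsi
    Q nu L L_rect b [set x | E x <= a] alpha alpha0; last first.
    exists eta => // x Ex A mA; rewrite PE outE; exact: eta_le.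
  move=> x i A /= Ex mA; set u := pos x i.
  have uM1 : enorm u <= M1 by exact: CM1.
  have Psiu : enorm (Psi u) ^+ 2 <= M1 ^+ 2 + Kh.
    have := kin u; have := trR u; have := enorm_ge0 u; nra.
  (* The part of [A] in the unit box, in terms of the noise [z] of the forecast [Psi u + z]; by the
     choice of [M2] it lies in the ball. *)
  pose A' := [set z | A (z + Psi u) /\ unit_box (z + Psi u)].
  have mA' : measurable A'.
    rewrite -[X in measurable X]setTI.
    have : measurable_fun setT (fun z : 'cV[R]_d => z + Psi u).
      by apply: measurable_addmx; [exact: measurable_id|exact: measurable_cst].
    move=> /(_ measurableT (A `&` @unit_box R d)); apply.
    by apply: measurableI => //; exact: measurable_unit_box.
  have A'ball : A' `&` eball M2 = A'.
    apply/setIidPl => z [_ zbox]; apply: enorm_le.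
      by rewrite addr_ge0// ?mulr_ge0// addr_ge0 ?sqr_ge0// ltW.
    by have := enorm_unit_box_sub zbox; lra.
  rewrite -(bE (Psi u))// -/A' -A'ball.
  apply: (le_trans (noise_le u uM1 _ mA')).
  apply: le_measure; rewrite ?inE//.
    rewrite -[X in measurable X]setTI.
    have : measurable_fun setT (fun z : 'cV[R]_d => Psi u + z).
      by apply: measurable_addmx; [exact: measurable_cst|exact: measurable_id].
    by apply.
  by move=> z [Az _]; rewrite /= addrC.
(* The state [0] is an arbitrary starting point for the laws that converge to [pi]. *)
have [pi [pi_inv pi_uniq [r [kappa [r01 kappa0 tv]]]]] :=
  harris mE E_ge0 gamma01 c_gt0 drift minor 0 law0 lawS.
exists pi; split.
- move=> A mA; rewrite -pi_inv//.
  by apply: eq_integral => x _; rewrite transE.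
- move=> pi' inv' A mA; apply: pi_uniq => // B mB.
  by rewrite -inv'//; apply: eq_integral => x _; rewrite transE.
exists r, kappa; split => // mu n.
rewrite (_ : pushforward _ _ = law mu n); first exact: tv.
by apply/funext => A; rewrite lawE.
Qed.
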